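(* Let $E$ be an arbitrary graph, $K$ any field, and let $I_{lce}=I(P_l(E))\oplus I(P_c(E))\oplus I(P_{ec}(E))\subseteq L_K(E)$. Then: (i) $$I_{lce}\cong\Big(\bigoplus_{i\in\Lambda_1}M_{m_i}(K)\Big)\oplus\Big(\bigoplus_{j\in\Lambda_2}M_{n_j}(K[x,x^{-1}])\Big)\oplus\Big(\bigoplus_{l\in\Lambda_3}I(\tilde c_{l}^{\,0})\Big)$$ for suitable (possibly infinite) cardinals $m_i,n_j$, where $\Lambda_1$ is the index set of the sinks of $E$, $\Lambda_2$ is the index set of the cycles without exits in $E$, and $\Lambda_3$ indexes $X_{ec}(E)=\{\tilde c_l : l\in\Lambda_3\}$. (ii) If $\vert E^0\vert<\infty$, then $I_{lce}$ is a dense ideal of $L_K(E)$.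
   Context: A directed graph is $E=(E^0,E^1,r,s)$ with vertex set $E^0$, edge set $E^1$ and range and source maps $r,s:E^1\to E^0$. A sink is a vertex which emits no edges. A vertex $v$ is regular if $s^{-1}(v)$ is finite and nonempty. The Leavitt path algebra $L_K(E)$ is the $K$-algebra generated by $E^0\cup E^1\cup\{e^*: e\in E^1\}$ with relations: $vw=\delta_{v,w}v$ for $v,w\in E^0$; $s(e)e=er(e)=e$ and $r(e)e^*=e^*s(e)=e^*$ for $e\in E^1$; $e^*e'=\delta_{e,e'}r(e)$ for $e,e'\in E^1$; and $v=\sum_{s(e)=v}ee^*$ for every regular $v$. $I(Y)$ is the two-sided ideal generated by a set $Y$ of vertices. For a cardinal $\kappa$, $M_\kappa(R)$ is the ring of $\kappa\times\kappa$ matrices over $R$ with finitely many nonzero entries. Write $v\ge w$ if there is a path from $v$ to $w$ and $T(v)=\{w:v\ge w\}$; $T(Y)=\bigcup_{v\in Y}T(v)$. A cycle is a path $\mu=e_1\dots e_n$ ($n\ge1$) with $s(\mu)=r(\mu)$ and $s(e_i)\ne s(e_j)$ for $i\neq j$; $\mu^0$ is its set of vertices. An exit of $\mu$ is an edge $e$ with $s(e)=s(e_i)$, $e\neq e_i$ for some $i$. $P_l(E)$ is the set of line points: vertices $v$ such that $T(v)$ contains neither bifurcations (vertices emitting at least two edges) nor cycles. $P_c(E)$ is the set of vertices in cycles without exits; cycles without exits are counted up to cyclic rotation. A cycle $c$ is extreme if it has exits and for every path $\lambda$ starting at a vertex of $c^0$ there is a path $\mu$ with $s(\mu)=r(\lambda)$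 and $r(\mu)\in c^0$; $P_{ec}(E)$ is the set of vertices in extreme cycles. Extreme cycles $c,d$ are equivalent iff $T(c^0)\cap d^0\neq\emptyset$; $X_{ec}(E)$ is the set of equivalence classes $\tilde c$ and $\tilde c^{\,0}$ is the set of all vertices of cycles in $\tilde c$. The sum of ideals defining $I_{lce}$ is direct. A right ideal $J$ of a ring $R$ is dense if for all $x,y\in R$ with $x\ne0$ there is $t\in R$ with $xt\neq0$ and $yt\in J$; dense left ideals are defined symmetrically; a dense ideal is one which is dense as a left and as a right ideal.
   Formalization: In (i), Λ_1 indexes the sinks together with the ''infinite sinks'' (classes of connected line points that reach no sink); with sinks alone (i) fails, e.g. for the graph v_0→v_1→v_2→…, which has no sinks or cycles although I_lce = L_K(E) ≠ 0. *)

(* Defs.v *)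
From HB Require Import structures.
From mathcomp Require Import all_boot all_order all_algebra.
From mathcomp Require Import finmap boolp classical_sets functions cardinality fsbigop.

Set Implicit Arguments.
Unset Strict Implicit.
Unset Printing Implicit Defensive.

Import GRing.Theory.

Local Open Scope classical_set_scope.
Local Open Scope ring_scope.

(* No unit is required: L_K(E) has none when E has infinitely many vertices. *)
HB.mixin Record Lmodule_isNUAlgebra (K : pzRingType) V of GRing.Lmodule K V := {
  nmul : V -> V -> V;
  nmulA : associative nmul;
  nmulDl : left_distributive nmul +%R;
  nmulDr : right_distributive nmul +%R;
  nmulZl : forall (k : K) x y, nmul (k *: x) y = k *: nmul x y;
  nmulZr : forall (k : K) x y, nmul x (k *: y) = k *: nmul x y
}.

#[short(type="nuAlgType")]
HB.structure Definition NUAlgebra (K : pzRingType) :=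
  { V of Lmodule_isNUAlgebra K V & GRing.Lmodule K V }.

Notation "x ** y" := (nmul x y) (at level 40, left associativity) : ring_scope.

Section NUAlgebraTheory.
Variables (K : pzRingType) (A : nuAlgType K).

Lemma nmul0 (x : A) : 0 ** x = 0.
Proof. by apply: (addrI (0 ** x)); rewrite -nmulDl !addr0. Qed.

Lemma nmulr0 (x : A) : x ** 0 = 0.
Proof. by apply: (addrI (x ** 0)); rewrite -nmulDr !addr0. Qed.

Lemma nmul_suml (I : Type) (r : seq I) (F : I -> A) (y : A) :
  (\sum_(i <- r) F i) ** y = \sum_(i <- r) F i ** y.
Proof.
by elim: r => [|i r IH]; rewrite ?big_nil ?nmul0// !big_cons nmulDl IH.
Qed.

Lemma nmul_sumr (I : Type) (r : seq I) (F : I -> A) (y : A) :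
  y ** (\sum_(i <- r) F i) = \sum_(i <- r) y ** F i.
Proof.
by elim: r => [|i r IH]; rewrite ?big_nil ?nmulr0// !big_cons nmulDr IH.
Qed.

End NUAlgebraTheory.

Definition nualg_iso (K : pzRingType) (A B : nuAlgType K) : Prop :=
  exists f : {linear A -> B},
    bijective f /\ forall x y, f (x ** y) = f x ** f y.

Section RegularNUAlgebra.
Variable K : comPzRingType.

Fact regular_nmulZr (k : K) (x y : K^o) : x * (k *: y) = k *: (x * y).
Proof. exact: mulrCA. Qed.

Fact regular_nmulZl (k : K) (x y : K^o) : (k *: x) * y = k *: (x * y).
Proof. by rewrite [RHS]mulrA. Qed.

HB.instance Definition _ := Lmodule_isNUAlgebra.Build K K^o
  (@mulrA K) (@mulrDl K) (@mulrDr K) regular_nmulZl regular_nmulZr.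

End RegularNUAlgebra.

Section PairNUAlgebra.
Variables (K : pzRingType) (A B : nuAlgType K).

Definition pair_nmul (x y : A * B) : A * B := (x.1 ** y.1, x.2 ** y.2).

Fact pair_nmulA : associative pair_nmul.
Proof. by move=> x y z; rewrite /pair_nmul/= !nmulA. Qed.
Fact pair_nmulDl : left_distributive pair_nmul +%R.
Proof. by move=> x y z; rewrite /pair_nmul/= !nmulDl. Qed.
Fact pair_nmulDr : right_distributive pair_nmul +%R.
Proof. by move=> x y z; rewrite /pair_nmul/= !nmulDr. Qed.
Fact pair_nmulZl (k : K) x y : pair_nmul (k *: x) y = k *: pair_nmul x y.
Proof. by rewrite /pair_nmul/= !nmulZl. Qed.
Fact pair_nmulZr (k : K) x y : pair_nmul x (k *: y) = k *: pair_nmul x y.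
Proof. by rewrite /pair_nmul/= !nmulZr. Qed.

HB.instance Definition _ := Lmodule_isNUAlgebra.Build K (A * B)%type
  pair_nmulA pair_nmulDl pair_nmulDr pair_nmulZl pair_nmulZr.

End PairNUAlgebra.

Section DirectSumModule.
Variables (K : pzRingType) (I : Type) (V : I -> lmodType K).

Record dsum := Dsum {
  dsum_fun :> forall i, V i;
  dsum_finite : finite_set [set i | dsum_fun i != 0] }.

HB.instance Definition _ := gen_eqMixin dsum.
HB.instance Definition _ := gen_choiceMixin dsum.

Lemma dsumP (f g : dsum) : (forall i, f i = g i) -> f = g.
Proof.
case: f g => [f ff] [g gf] /= fg.
have {}fg : f = g by apply: functional_extensionality_dep.
by case: _ / fg gf => gf; rewrite (Prop_irrelevance ff gf).
Qed.

Fact dsum0_finite : finite_set [set i | (0 : V i) != 0].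
Proof. by apply: (@sub_finite_set _ _ set0) => // i /=; rewrite eqxx. Qed.
Definition dsum0 := Dsum dsum0_finite.

Fact dsumN_finite (f : dsum) : finite_set [set i | - f i != 0].
Proof.
by apply: sub_finite_set (dsum_finite f) => i /=; rewrite oppr_eq0.
Qed.
Definition dsumN f := Dsum (dsumN_finite f).

Fact dsumD_finite (f g : dsum) : finite_set [set i | f i + g i != 0].
Proof.
apply: (@sub_finite_set _ _ ([set i | f i != 0] `|` [set i | g i != 0])).
  move=> i /=; have [-> |] := eqVneq (f i) 0; last by left.
  by rewrite add0r; right.
by rewrite finite_setU; split; exact: dsum_finite.
Qed.
Definition dsumD f g := Dsum (dsumD_finite f g).

Fact dsumZ_finite (k : K) (f : dsum) : finite_set [set i | k *: f i != 0].
Proof.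
by apply: sub_finite_set (dsum_finite f) => i /=; apply: contra_neq => ->;
  rewrite scaler0.
Qed.
Definition dsumZ k f := Dsum (dsumZ_finite k f).

Fact dsumDA : associative dsumD.
Proof. by move=> f g h; apply: dsumP => i /=; rewrite addrA. Qed.
Fact dsumDC : commutative dsumD.
Proof. by move=> f g; apply: dsumP => i /=; rewrite addrC. Qed.
Fact dsum0D : left_id dsum0 dsumD.
Proof. by move=> f; apply: dsumP => i /=; rewrite add0r. Qed.
Fact dsumND : left_inverse dsum0 dsumN dsumD.
Proof. by move=> f; apply: dsumP => i /=; rewrite addNr. Qed.

HB.instance Definition _ :=
  GRing.isZmodule.Build dsum dsumDA dsumDC dsum0D dsumND.

Fact dsumZA a b f : dsumZ a (dsumZ b f) = dsumZ (a * b) f.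
Proof. by apply: dsumP => i /=; rewrite scalerA. Qed.
Fact dsum1Z : left_id 1 dsumZ.
Proof. by move=> f; apply: dsumP => i /=; rewrite scale1r. Qed.
Fact dsumZDr : right_distributive dsumZ +%R.
Proof. by move=> k f g; apply: dsumP => i /=; rewrite scalerDr. Qed.
Fact dsumZDl f : {morph dsumZ^~ f : a b / a + b}.
Proof. by move=> a b; apply: dsumP => i /=; rewrite scalerDl. Qed.

HB.instance Definition _ :=
  GRing.Zmodule_isLmodule.Build K dsum dsumZA dsum1Z dsumZDr dsumZDl.

Lemma dsumDE (f g : dsum) i : (f + g) i = f i + g i. Proof. by []. Qed.
Lemma dsumZE k (f : dsum) i : (k *: f) i = k *: f i. Proof. by []. Qed.

End DirectSumModule.

Section DirectSumAlgebra.
Variables (K : pzRingType) (I : Type) (A : I -> nuAlgType K).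
Implicit Types f g h : dsum A.

Fact dsum_nmul_finite f g : finite_set [set i | f i ** g i != 0].
Proof.
by apply: sub_finite_set (dsum_finite f) => i /=; apply: contra_neq => ->;
  rewrite nmul0.
Qed.
Definition dsum_nmul f g : dsum A := Dsum (dsum_nmul_finite f g).

Fact dsum_nmulA : associative dsum_nmul.
Proof. by move=> f g h; apply: dsumP => i /=; rewrite nmulA. Qed.
Fact dsum_nmulDl : left_distributive dsum_nmul +%R.
Proof. by move=> f g h; apply: dsumP => i /=; rewrite nmulDl. Qed.
Fact dsum_nmulDr : right_distributive dsum_nmul +%R.
Proof. by move=> f g h; apply: dsumP => i /=; rewrite nmulDr. Qed.
Fact dsum_nmulZl (k : K) f g : dsum_nmul (k *: f) g = k *: dsum_nmul f g.
Proof. by apply: dsumP => i /=; rewrite nmulZl. Qed.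
Fact dsum_nmulZr (k : K) f g : dsum_nmul f (k *: g) = k *: dsum_nmul f g.
Proof. by apply: dsumP => i /=; rewrite nmulZr. Qed.

HB.instance Definition _ := Lmodule_isNUAlgebra.Build K (dsum A)
  dsum_nmulA dsum_nmulDl dsum_nmulDr dsum_nmulZl dsum_nmulZr.

End DirectSumAlgebra.

Lemma fsumTE (X : choiceType) (M : zmodType) (S : set X) (F : X -> M) :
  finite_set S -> (forall x, F x <> 0 -> S x) ->
  \sum_(x \in [set: X]) F x = \sum_(x <- fset_set S) F x.
Proof.
move=> Sfin FS; rewrite -(fsbig_finite _ _ Sfin).
apply/esym/fsbig_widen => // x [_ nSx] /=.
by apply: contrapT => /FS.
Qed.

(* [fmatrix X R] is M_kappa(R), where kappa is the cardinality of [X]. *)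
Definition fmatrix (K : pzRingType) (X : choiceType) (R : lmodType K) :=
  dsum (fun _ : X * X => R).

HB.instance Definition _ (K : pzRingType) (X : choiceType) (R : lmodType K) :=
  GRing.Lmodule.on (fmatrix X R).

Section MatrixAlgebra.
Variables (K : pzRingType) (X : choiceType) (R : nuAlgType K).
Implicit Types f g h : fmatrix X R.

Definition fmatrix_nmul_fun f g (ij : X * X) : R :=
  \sum_(x \in [set: X]) f (ij.1, x) ** g (x, ij.2).

Lemma fmatrix_nmul_funEl f g S ij : finite_set S ->
    (forall i x, f (i, x) <> 0 -> S x) ->
  fmatrix_nmul_fun f g ij = \sum_(x <- fset_set S) f (ij.1, x) ** g (x, ij.2).
Proof.
move=> Sfin fS; apply: fsumTE => // x fgx; apply: (fS ij.1).
by apply: contra_not fgx => ->; rewrite nmul0.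
Qed.

Lemma fmatrix_nmul_funEr f g S ij : finite_set S ->
    (forall x j, g (x, j) <> 0 -> S x) ->
  fmatrix_nmul_fun f g ij = \sum_(x <- fset_set S) f (ij.1, x) ** g (x, ij.2).
Proof.
move=> Sfin gS; apply: fsumTE => // x fgx; apply: (gS _ ij.2).
by apply: contra_not fgx => ->; rewrite nmulr0.
Qed.

Lemma fmatrix_finite2 f : finite_set [set x | exists i, f (i, x) <> 0].
Proof.
apply: sub_finite_set (finite_image snd (dsum_finite f)) => x [i /eqP fix0].
by exists (i, x).
Qed.

Lemma fmatrix_finite1 f : finite_set [set x | exists j, f (x, j) <> 0].
Proof.
apply: sub_finite_set (finite_image fst (dsum_finite f)) => x [i /eqP fix0].
by exists (x, i).
Qed.

Fact fmatrix_nmul_finite f g :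
  finite_set [set ij | fmatrix_nmul_fun f g ij != 0].
Proof.
apply: sub_finite_set (finite_setX (fmatrix_finite1 f) (fmatrix_finite2 g)).
move=> [i j] /= /eqP fg0; apply: contrapT => /not_andP fg.
apply: fg0; apply: fsbig1 => x _ /=.
by case: fg => /forallNP/(_ x)/contrapT ->; rewrite ?nmul0 ?nmulr0.
Qed.
Definition fmatrix_nmul f g : fmatrix X R := Dsum (fmatrix_nmul_finite f g).

Fact fmatrix_nmulA : associative fmatrix_nmul.
Proof.
move=> f g h; apply: dsumP => -[i j] /=.
have fS := fmatrix_finite2 f; have hS := fmatrix_finite1 h.
rewrite (fmatrix_nmul_funEl _ _ fS); last by move=> k x; exists k.
rewrite (fmatrix_nmul_funEr _ _ hS); last by move=> x k; exists k.
under eq_bigr => x _.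
  rewrite /= (fmatrix_nmul_funEr _ _ hS); last by move=> y k; exists k.
  rewrite nmul_sumr; over.
under [RHS]eq_bigr => y _.
  rewrite /= (fmatrix_nmul_funEl _ _ fS); last by move=> k x; exists k.
  rewrite nmul_suml; over.
rewrite exchange_big /=; apply: eq_bigr => x _; apply: eq_bigr => y _.
by rewrite nmulA.
Qed.

Fact fmatrix_nmulDl : left_distributive fmatrix_nmul +%R.
Proof.
move=> f g h; apply: dsumP => ij; rewrite dsumDE /=.
have hS := fmatrix_finite1 h.
rewrite !(fmatrix_nmul_funEr _ _ hS); do ?by move=> x k; exists k.
by rewrite -big_split; apply: eq_bigr => x _; rewrite dsumDE nmulDl.
Qed.

Fact fmatrix_nmulDr : right_distributive fmatrix_nmul +%R.
Proof.
move=> f g h; apply: dsumP => ij; rewrite dsumDE /=.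
have fS := fmatrix_finite2 f.
rewrite !(fmatrix_nmul_funEl _ _ fS); do ?by move=> x k; exists x.
all: do ?by move=> k x; exists k.
by rewrite -big_split; apply: eq_bigr => x _; rewrite dsumDE nmulDr.
Qed.

Fact fmatrix_nmulZl (k : K) f g :
  fmatrix_nmul (k *: f) g = k *: fmatrix_nmul f g.
Proof.
apply: dsumP => ij; rewrite dsumZE /=; have gS := fmatrix_finite1 g.
rewrite !(fmatrix_nmul_funEr _ _ gS); do ?by move=> x l; exists l.
by rewrite scaler_sumr; apply: eq_bigr => x _; rewrite dsumZE nmulZl.
Qed.

Fact fmatrix_nmulZr (k : K) f g :
  fmatrix_nmul f (k *: g) = k *: fmatrix_nmul f g.
Proof.
apply: dsumP => ij; rewrite dsumZE /=; have fS := fmatrix_finite2 f.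
rewrite !(fmatrix_nmul_funEl _ _ fS); do ?by move=> l x; exists l.
by rewrite scaler_sumr; apply: eq_bigr => x _; rewrite dsumZE nmulZr.
Qed.

HB.instance Definition _ := Lmodule_isNUAlgebra.Build K (fmatrix X R)
  fmatrix_nmulA fmatrix_nmulDl fmatrix_nmulDr fmatrix_nmulZl fmatrix_nmulZr.

End MatrixAlgebra.

(* The element [p : laurent K] is the sum of the [p n *: x ^ n] for [n : int]. *)
Definition laurent (K : pzRingType) := dsum (fun _ : int => K^o).

HB.instance Definition _ (K : pzRingType) := GRing.Lmodule.on (laurent K).

Section LaurentAlgebra.
Variable K : comPzRingType.
Implicit Types p q r : laurent K.

Definition laurent_nmul_fun p q (n : int) : K^o :=
  \sum_(i \in [set: int]) p i * q (n - i).

Lemma laurent_nmul_funE p q S n : finite_set S ->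
    (forall i, p i <> 0 -> S i) ->
  laurent_nmul_fun p q n = \sum_(i <- fset_set S) p i * q (n - i).
Proof.
move=> Sfin pS; apply: fsumTE => // i pqi; apply: pS.
by apply: contra_not pqi => ->; rewrite mul0r.
Qed.

Lemma laurent_nmul_funC p q n : laurent_nmul_fun p q n = laurent_nmul_fun q p n.
Proof.
rewrite /laurent_nmul_fun (reindex_fsbigT (fun i : int => n - i)); last first.
  by exists (fun i : int => n - i) => i; rewrite subKr.
by apply: eq_fsbigr => i _; rewrite subKr mulrC.
Qed.

Lemma laurent_finite p : finite_set [set i | p i <> 0].
Proof. by apply: sub_finite_set (dsum_finite p) => i /eqP. Qed.

Fact laurent_nmul_finite p q : finite_set [set n | laurent_nmul_fun p q n != 0].
Proof.
apply: sub_finite_set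
  (finite_image2 +%R (laurent_finite p) (laurent_finite q)).
move=> n /= /eqP pq0; apply: contrapT => pq; apply: pq0.
apply: fsbig1 => i _; have [->|/eqP pi] := eqVneq (p i) 0; first exact: mul0r.
have [->|/eqP qi] := eqVneq (q (n - i)) 0; first exact: mulr0.
by case: pq; exists i => //; exists (n - i) => //; rewrite addrC subrK.
Qed.
Definition laurent_nmul p q : laurent K := Dsum (laurent_nmul_finite p q).

Fact laurent_nmulC : commutative laurent_nmul.
Proof. by move=> p q; apply: dsumP => n /=; exact: laurent_nmul_funC. Qed.

Fact laurent_nmulA : associative laurent_nmul.
Proof.
move=> p q r; rewrite (laurent_nmulC q) [RHS]laurent_nmulC.
apply: dsumP => n /=.
have pS := laurent_finite p; have rS := laurent_finite r.
rewrite (laurent_nmul_funE _ _ pS)//.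
rewrite (laurent_nmul_funE _ _ rS)//.
under eq_bigr => i _.
  rewrite /= (laurent_nmul_funE _ _ rS)// mulr_sumr; over.
under [RHS]eq_bigr => i _.
  rewrite /= (laurent_nmul_funE _ _ pS)// mulr_sumr; over.
rewrite exchange_big /=; apply: eq_bigr => i _; apply: eq_bigr => j _.
by rewrite mulrCA addrAC.
Qed.

Fact laurent_nmulDl : left_distributive laurent_nmul +%R.
Proof.
move=> p q r; rewrite ![laurent_nmul _ r]laurent_nmulC.
apply: dsumP => n; rewrite dsumDE /=; have rS := laurent_finite r.
rewrite !(laurent_nmul_funE _ _ rS)// -big_split.
by apply: eq_bigr => i _; rewrite dsumDE mulrDr.
Qed.

Fact laurent_nmulDr : right_distributive laurent_nmul +%R.
Proof. by move=> p q r; rewrite ![laurent_nmul p _]laurent_nmulC laurent_nmulDl. Qed.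

Fact laurent_nmulZr (k : K) p q : laurent_nmul p (k *: q) = k *: laurent_nmul p q.
Proof.
apply: dsumP => n; rewrite dsumZE /=; have pS := laurent_finite p.
rewrite !(laurent_nmul_funE _ _ pS)// scaler_sumr.
by apply: eq_bigr => i _; rewrite dsumZE [LHS]mulrCA.
Qed.

Fact laurent_nmulZl (k : K) p q : laurent_nmul (k *: p) q = k *: laurent_nmul p q.
Proof. by rewrite laurent_nmulC laurent_nmulZr laurent_nmulC. Qed.

HB.instance Definition _ := Lmodule_isNUAlgebra.Build K (laurent K)
  laurent_nmulA laurent_nmulDl laurent_nmulDr laurent_nmulZl laurent_nmulZr.

End LaurentAlgebra.

Section Ideals.
Variables (K : pzRingType) (A : nuAlgType K).

Record is_ideal (J : set A) : Prop := IsIdeal {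
  is_ideal0 : J 0;
  is_idealD : forall x y, J x -> J y -> J (x + y);
  is_idealZ : forall (k : K) x, J x -> J (k *: x);
  is_idealMl : forall a x, J x -> J (a ** x);
  is_idealMr : forall a x, J x -> J (x ** a) }.

Record ideal := Ideal { ideal_set :> set A; idealP : is_ideal ideal_set }.

Fact ideal_gen_is_ideal (Y : set A) : is_ideal (smallest is_ideal Y).
Proof.
split.
- by move=> J [Jid _]; exact: is_ideal0.
- by move=> x y Yx Yy J JY; apply: is_idealD (JY.1) _ _ (Yx J JY) (Yy J JY).
- by move=> k x Yx J JY; apply: is_idealZ (JY.1) _ _ (Yx J JY).
- by move=> a x Yx J JY; apply: is_idealMl (JY.1) _ _ (Yx J JY).
- by move=> a x Yx J JY; apply: is_idealMr (JY.1) _ _ (Yx J JY).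
Qed.
Definition ideal_gen (Y : set A) : ideal := Ideal (ideal_gen_is_ideal Y).

Fact ideal_add_is_ideal (I J : ideal) :
  is_ideal [set x + y | x in (I : set A) & y in (J : set A)].
Proof.
case: I J => [I Iid] [J Jid] /=; split.
- by exists 0; [exact: is_ideal0|exists 0; [exact: is_ideal0|rewrite addr0]].
- move=> _ _ [x Ix [y Jy <-]] [x' Ix' [y' Jy' <-]].
  exists (x + x'); first exact: is_idealD.
  by exists (y + y'); [exact: is_idealD|rewrite addrACA].
- move=> k _ [x Ix [y Jy <-]]; exists (k *: x); first exact: is_idealZ.
  by exists (k *: y); [exact: is_idealZ|rewrite scalerDr].
- move=> a _ [x Ix [y Jy <-]]; exists (a ** x); first exact: is_idealMl.
  by exists (a ** y); [exact: is_idealMl|rewrite nmulDr].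
- move=> a _ [x Ix [y Jy <-]]; exists (x ** a); first exact: is_idealMr.
  by exists (y ** a); [exact: is_idealMr|rewrite nmulDl].
Qed.
Definition ideal_add (I J : ideal) : ideal := Ideal (ideal_add_is_ideal I J).

Section IdealAlgebra.
Variable J : ideal.

Definition ideal_pred : pred A := fun x => `[< ideal_set J x >].

Fact ideal_pred_closed : subsemimod_closed ideal_pred.
Proof.
have Jid := idealP J; split; first split.
- by apply/asboolP; exact: is_ideal0.
- by move=> x y /asboolP Jx /asboolP Jy; apply/asboolP; exact: is_idealD.
- by move=> k x /asboolP Jx; apply/asboolP; exact: is_idealZ.
Qed.

HB.instance Definition _ :=
  GRing.isSubmodClosed.Build K A ideal_pred ideal_pred_closed.

Definition ideal_sort : Type := {x : A | ideal_pred x}.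

HB.instance Definition _ := SubChoice.on ideal_sort.
HB.instance Definition _ := [SubChoice_isSubLmodule of ideal_sort by <:].

Fact ideal_nmul_closed (x y : ideal_sort) : ideal_pred (\val x ** \val y).
Proof.
by apply/asboolP/(is_idealMr (idealP J))/asboolP; exact: (valP x).
Qed.
Definition ideal_nmul (x y : ideal_sort) : ideal_sort :=
  exist _ (\val x ** \val y) (ideal_nmul_closed x y).

Fact ideal_nmulA : associative ideal_nmul.
Proof. by move=> x y z; apply: val_inj; rewrite /= nmulA. Qed.
Fact ideal_nmulDl : left_distributive ideal_nmul +%R.
Proof. by move=> x y z; apply: val_inj; rewrite /= nmulDl. Qed.
Fact ideal_nmulDr : right_distributive ideal_nmul +%R.
Proof. by move=> x y z; apply: val_inj; rewrite /= nmulDr. Qed.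
Fact ideal_nmulZl (k : K) x y : ideal_nmul (k *: x) y = k *: ideal_nmul x y.
Proof. by apply: val_inj; rewrite /= nmulZl. Qed.
Fact ideal_nmulZr (k : K) x y : ideal_nmul x (k *: y) = k *: ideal_nmul x y.
Proof. by apply: val_inj; rewrite /= nmulZr. Qed.

HB.instance Definition _ := Lmodule_isNUAlgebra.Build K ideal_sort
  ideal_nmulA ideal_nmulDl ideal_nmulDr ideal_nmulZl ideal_nmulZr.

End IdealAlgebra.

Definition additive_subgroup (J : set A) : Prop :=
  J 0 /\ forall x y, J x -> J y -> J (x - y).

Definition right_ideal (J : set A) : Prop :=
  additive_subgroup J /\ forall x a, J x -> J (x ** a).

Definition left_ideal (J : set A) : Prop :=
  additive_subgroup J /\ forall x a, J x -> J (a ** x).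

Definition dense_right_ideal (J : set A) : Prop :=
  right_ideal J /\
  forall x y : A, x <> 0 -> exists t : A, x ** t <> 0 /\ J (y ** t).

Definition dense_left_ideal (J : set A) : Prop :=
  left_ideal J /\
  forall x y : A, x <> 0 -> exists t : A, t ** x <> 0 /\ J (t ** y).

Definition dense_ideal (J : set A) : Prop :=
  dense_left_ideal J /\ dense_right_ideal J.

End Ideals.

(* Asking for [choiceType]s is no restriction on the graph: every type has a
   choice structure, see [gen_eqMixin] and [gen_choiceMixin] in [boolp]. *)
Record digraph := Digraph {
  vertex : choiceType;
  edge : choiceType;
  source : edge -> vertex;
  target : edge -> vertex }.

Arguments source {d} _.
Arguments target {d} _.

Section Graph.
Variable E : digraph.
Implicit Types (u v w : vertex E) (e f : edge E) (p c d : seq (edge E)).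

Definition emitted v : set (edge E) := [set e | source e = v].

Definition sinks : set (vertex E) := [set v | emitted v = set0].

Definition regular v : Prop := finite_set (emitted v) /\ emitted v !=set0.

Fixpoint is_path v p w : Prop :=
  if p is e :: p' then source e = v /\ is_path (target e) p' w else v = w.

Definition tree v : set (vertex E) := [set w | exists p, is_path v p w].

Definition trees (Y : set (vertex E)) : set (vertex E) :=
  \bigcup_(v in Y) tree v.

Definition cycles : set (seq (edge E)) :=
  [set c | [/\ c <> [::], exists v, is_path v c v & uniq (map source c)]].

Definition cycle_vertices c : set (vertex E) :=
  [set v | exists2 e, e \in c & source e = v].

Definition exits c : set (edge E) :=
  [set e | exists2 f, f \in c & source e = source f /\ e <> f].

Definition bifurcations : set (vertex E) :=
  [set v | exists e f, [/\ emitted v e, emitted v f & e <> f]].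

Definition P_l : set (vertex E) :=
  [set v | forall w, tree v w ->
     ~ bifurcations w /\ ~ exists2 c, cycles c & cycle_vertices c w].

Definition noexit_cycles : set (seq (edge E)) :=
  [set c | cycles c /\ exits c = set0].

(* The line points from which no sink can be reached: the only infinite path
   starting at such a vertex visits infinitely many vertices. *)
Definition sinkless_line_points : set (vertex E) :=
  [set v | P_l v /\ tree v `&` sinks = set0].

(* The infinite sinks: the eventually merging infinite paths of sinkless line
   points, represented by the set of line points leading to them. *)
Definition infinite_sinks : set (set (vertex E)) :=
  [set [set w | sinkless_line_points w /\ tree v `&` tree w !=set0]
    | v in sinkless_line_points].

(* A class of connected line points contains at most one sink. The classes
   without a sink also contribute simple direct summands to I(P_l), so that the
   sinks alone index all the summands only if there is no infinite sink (for
   instance if the graph has finitely many vertices). *)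
Definition Lambda1 : Type := (sinks + infinite_sinks)%type.

Definition P_c : set (vertex E) :=
  \bigcup_(c in noexit_cycles) cycle_vertices c.

Definition extreme_cycles : set (seq (edge E)) :=
  [set c | [/\ cycles c, exits c !=set0 &
     forall v p w, cycle_vertices c v -> is_path v p w ->
       exists q u, is_path w q u /\ cycle_vertices c u]].

Definition P_ec : set (vertex E) :=
  \bigcup_(c in extreme_cycles) cycle_vertices c.

Definition rotations c : set (seq (edge E)) := [set rot n c | n in [set: nat]].

Definition noexit_classes : set (set (seq (edge E))) :=
  [set rotations c | c in noexit_cycles].

Definition extreme_class c : set (seq (edge E)) :=
  [set d | extreme_cycles d /\
     trees (cycle_vertices c) `&` cycle_vertices d !=set0].

Definition X_ec : set (set (seq (edge E))) :=
  [set extreme_class c | c in extreme_cycles].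

Definition class_vertices (C : set (seq (edge E))) : set (vertex E) :=
  \bigcup_(d in C) cycle_vertices d.

End Graph.

Arguments sinks E : clear implicits.
Arguments P_l E : clear implicits.
Arguments sinkless_line_points E : clear implicits.
Arguments infinite_sinks E : clear implicits.
Arguments Lambda1 E : clear implicits.
Arguments noexit_cycles E : clear implicits.
Arguments noexit_classes E : clear implicits.
Arguments P_c E : clear implicits.
Arguments extreme_cycles E : clear implicits.
Arguments P_ec E : clear implicits.
Arguments X_ec E : clear implicits.

Section LeavittPathAlgebra.
Variables (K : fieldType) (E : digraph).

Inductive lterm :=
| LZero
| LVertex of vertex E
| LEdge of edge E
| LGhost of edge E
| LAdd of lterm & lterm
| LScale of K & lterm
| LMul of lterm & lterm.

Inductive lrel : lterm -> lterm -> Prop :=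
| lrel_refl x : lrel x x
| lrel_sym x y : lrel x y -> lrel y x
| lrel_trans x y z : lrel x y -> lrel y z -> lrel x z
| lrel_add x x' y y' : lrel x x' -> lrel y y' -> lrel (LAdd x y) (LAdd x' y')
| lrel_scale k x x' : lrel x x' -> lrel (LScale k x) (LScale k x')
| lrel_mul x x' y y' : lrel x x' -> lrel y y' -> lrel (LMul x y) (LMul x' y')
| lrel_addA x y z : lrel (LAdd x (LAdd y z)) (LAdd (LAdd x y) z)
| lrel_addC x y : lrel (LAdd x y) (LAdd y x)
| lrel_add0 x : lrel (LAdd LZero x) x
| lrel_addN x : lrel (LAdd (LScale (-1) x) x) LZero
| lrel_scaleA k l x : lrel (LScale k (LScale l x)) (LScale (k * l) x)
| lrel_scale1 x : lrel (LScale 1 x) x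
| lrel_scaleDr k x y :
    lrel (LScale k (LAdd x y)) (LAdd (LScale k x) (LScale k y))
| lrel_scaleDl k l x : lrel (LScale (k + l) x) (LAdd (LScale k x) (LScale l x))
| lrel_mulA x y z : lrel (LMul x (LMul y z)) (LMul (LMul x y) z)
| lrel_mulDl x y z : lrel (LMul (LAdd x y) z) (LAdd (LMul x z) (LMul y z))
| lrel_mulDr x y z : lrel (LMul x (LAdd y z)) (LAdd (LMul x y) (LMul x z))
| lrel_mulZl k x y : lrel (LMul (LScale k x) y) (LScale k (LMul x y))
| lrel_mulZr k x y : lrel (LMul x (LScale k y)) (LScale k (LMul x y))
| lrel_vertex v w :
    lrel (LMul (LVertex v) (LVertex w)) (if v == w then LVertex v else LZero)
| lrel_source e : lrel (LMul (LVertex (source e)) (LEdge e)) (LEdge e)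
| lrel_target e : lrel (LMul (LEdge e) (LVertex (target e))) (LEdge e)
| lrel_ghost_target e :
    lrel (LMul (LVertex (target e)) (LGhost e)) (LGhost e)
| lrel_ghost_source e :
    lrel (LMul (LGhost e) (LVertex (source e))) (LGhost e)
| lrel_CK1 e f :
    lrel (LMul (LGhost e) (LEdge f))
         (if e == f then LVertex (target e) else LZero)
| lrel_CK2 v : regular v ->
    lrel (LVertex v)
         (\big[LAdd/LZero]_(e <- fset_set (emitted v))
            LMul (LEdge e) (LGhost e)).

HB.instance Definition _ := gen_eqMixin lterm.
HB.instance Definition _ := gen_choiceMixin lterm.

Definition lequiv : rel lterm := fun x y => `[< lrel x y >].

Fact lequiv_refl : reflexive lequiv.
Proof. by move=> x; apply/asboolP; exact: lrel_refl. Qed.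
Fact lequiv_sym : symmetric lequiv.
Proof. by move=> x y; apply/asboolP/asboolP; exact: lrel_sym. Qed.
Fact lequiv_trans : transitive lequiv.
Proof.
by move=> y x z /asboolP xy /asboolP yz; apply/asboolP/(lrel_trans xy).
Qed.

Canonical lequiv_equiv := EquivRel lequiv lequiv_refl lequiv_sym lequiv_trans.

Local Open Scope quotient_scope.

Definition leavitt : Type := {eq_quot lequiv}.
HB.instance Definition _ := EqQuotient.on leavitt.
HB.instance Definition _ := Choice.on leavitt.

Definition lclass (x : lterm) : leavitt := \pi_leavitt x.

Lemma lclassP x y : lclass x = lclass y <-> lrel x y.
Proof.
split=> [/eqP|xy]; first by rewrite /lclass (eqmodE lequiv_equiv) => /asboolP.
by apply/eqP; rewrite /lclass (eqmodE lequiv_equiv); apply/asboolP.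
Qed.

Lemma lclass_repr (a : leavitt) : lclass (repr a) = a.
Proof. exact: reprK. Qed.

Lemma lrel_repr x : lrel (repr (lclass x)) x.
Proof. by apply/lclassP; rewrite lclass_repr. Qed.

Lemma lclass_ind (P : leavitt -> Prop) :
  (forall x, P (lclass x)) -> forall a, P a.
Proof. by move=> Px a; rewrite -(lclass_repr a). Qed.

Definition leavitt_add (a b : leavitt) : leavitt :=
  lclass (LAdd (repr a) (repr b)).
Definition leavitt_scale (k : K) (a : leavitt) : leavitt :=
  lclass (LScale k (repr a)).
Definition leavitt_mul (a b : leavitt) : leavitt :=
  lclass (LMul (repr a) (repr b)).

Lemma leavitt_addE x y : leavitt_add (lclass x) (lclass y) = lclass (LAdd x y).
Proof. by apply/lclassP; apply: lrel_add; exact: lrel_repr. Qed.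
Lemma leavitt_scaleE k x : leavitt_scale k (lclass x) = lclass (LScale k x).
Proof. by apply/lclassP; apply: lrel_scale; exact: lrel_repr. Qed.
Lemma leavitt_mulE x y : leavitt_mul (lclass x) (lclass y) = lclass (LMul x y).
Proof. by apply/lclassP; apply: lrel_mul; exact: lrel_repr. Qed.

Let leavittE := (leavitt_addE, leavitt_scaleE, leavitt_mulE).

Fact leavitt_addA : associative leavitt_add.
Proof.
elim/lclass_ind => x; elim/lclass_ind => y; elim/lclass_ind => z.
by rewrite !leavittE; apply/lclassP; exact: lrel_addA.
Qed.
Fact leavitt_addC : commutative leavitt_add.
Proof.
elim/lclass_ind => x; elim/lclass_ind => y.
by rewrite !leavittE; apply/lclassP; exact: lrel_addC.
Qed.
Fact leavitt_add0 : left_id (lclass LZero) leavitt_add.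
Proof.
elim/lclass_ind => x; rewrite !leavittE; apply/lclassP; exact: lrel_add0.
Qed.
Fact leavitt_addN :
  left_inverse (lclass LZero) (leavitt_scale (-1)) leavitt_add.
Proof.
elim/lclass_ind => x; rewrite !leavittE; apply/lclassP; exact: lrel_addN.
Qed.

HB.instance Definition _ := GRing.isZmodule.Build leavitt
  leavitt_addA leavitt_addC leavitt_add0 leavitt_addN.

Fact leavitt_scaleA k l a :
  leavitt_scale k (leavitt_scale l a) = leavitt_scale (k * l) a.
Proof.
elim/lclass_ind: a => x; rewrite !leavittE; apply/lclassP.
exact: lrel_scaleA.
Qed.
Fact leavitt_scale1 : left_id 1 leavitt_scale.
Proof.
elim/lclass_ind => x; rewrite !leavittE; apply/lclassP; exact: lrel_scale1.
Qed.
Fact leavitt_scaleDr : right_distributive leavitt_scale +%R.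
Proof.
move=> k; elim/lclass_ind => x; elim/lclass_ind => y.
by rewrite /+%R/= !leavittE; apply/lclassP; exact: lrel_scaleDr.
Qed.
Fact leavitt_scaleDl a : {morph leavitt_scale^~ a : k l / k + l}.
Proof.
elim/lclass_ind: a => x k l; rewrite [RHS]/+%R/= !leavittE; apply/lclassP.
exact: lrel_scaleDl.
Qed.

HB.instance Definition _ := GRing.Zmodule_isLmodule.Build K leavitt
  leavitt_scaleA leavitt_scale1 leavitt_scaleDr leavitt_scaleDl.

Fact leavitt_mulA : associative leavitt_mul.
Proof.
elim/lclass_ind => x; elim/lclass_ind => y; elim/lclass_ind => z.
by rewrite !leavittE; apply/lclassP; exact: lrel_mulA.
Qed.
Fact leavitt_mulDl : left_distributive leavitt_mul +%R.
Proof.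
elim/lclass_ind => x; elim/lclass_ind => y; elim/lclass_ind => z.
by rewrite /+%R/= !leavittE; apply/lclassP; exact: lrel_mulDl.
Qed.
Fact leavitt_mulDr : right_distributive leavitt_mul +%R.
Proof.
elim/lclass_ind => x; elim/lclass_ind => y; elim/lclass_ind => z.
by rewrite /+%R/= !leavittE; apply/lclassP; exact: lrel_mulDr.
Qed.
Fact leavitt_mulZl (k : K) (a b : leavitt) :
  leavitt_mul (k *: a) b = k *: leavitt_mul a b.
Proof.
elim/lclass_ind: a => x; elim/lclass_ind: b => y.
by rewrite /( *:%R)/= !leavittE; apply/lclassP; exact: lrel_mulZl.
Qed.
Fact leavitt_mulZr (k : K) (a b : leavitt) :
  leavitt_mul a (k *: b) = k *: leavitt_mul a b.
Proof.
elim/lclass_ind: a => x; elim/lclass_ind: b => y.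
by rewrite /( *:%R)/= !leavittE; apply/lclassP; exact: lrel_mulZr.
Qed.

HB.instance Definition _ := Lmodule_isNUAlgebra.Build K leavitt
  leavitt_mulA leavitt_mulDl leavitt_mulDr leavitt_mulZl leavitt_mulZr.

Definition vertex_ideal (Y : set (vertex E)) : ideal leavitt :=
  ideal_gen [set lclass (LVertex v) | v in Y].

Definition I_lce : ideal leavitt :=
  ideal_add (ideal_add (vertex_ideal (P_l E)) (vertex_ideal (P_c E)))
            (vertex_ideal (P_ec E)).

End LeavittPathAlgebra.

Arguments leavitt K E : clear implicits.
Arguments vertex_ideal K {E} Y.
Arguments I_lce K E : clear implicits.

(* Main.v *)
(* Everything is computed in the span of the monomials [p q*], for paths [p], [q]
   with the same end. Real paths with the same end are linearly independent, by
   a representation of L_K(E) on functions on a branching system; and an element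
   of the left ideal generated by ghost paths [q*] which vanishes against all of
   these [q] is zero, since the idempotents [q q*] commute. The latter makes the
   annihilator of I(Y) in I(Y) trivial, so that sums of pairwise orthogonal
   ideals I(Y) are direct.
   If no vertex of T(v) is a bifurcation, then [z z* = v] for every path [z]
   starting at v. Let X be the set of the paths [p] that meet T(v) in their end
   only, and for [p] in X let [z] be a chosen path from v to the end of [p]: the
   elements [p z*] yield matrix units that identify I(v) with the matrices over
   the corner [v L v] indexed by X. This corner is K v if v is a line point, and
   K[c, c*] if v lies on a cycle c without exits.
   For (ii), let [x] be nonzero. For some path [q], [x q] is a nonzero
   combination of real paths with the same end. It stays nonzero when multiplied
   by a further path, and if there are finitely many vertices such a path leads
   to a line point, a cycle without exits or an extreme cycle. Hence
   [x I_lce <> 0], and [I_lce x <> 0] follows by the involution. *)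

Require Import Defs.
From HB Require Import structures.
From mathcomp Require Import all_boot all_order all_algebra.
From mathcomp Require Import finmap boolp classical_sets functions cardinality fsbigop.
From mathcomp Require Import zify.

Set Implicit Arguments.
Unset Strict Implicit.
Unset Printing Implicit Defensive.

Import GRing.Theory.

Local Open Scope classical_set_scope.
Local Open Scope ring_scope.

(** * Non-unital algebras and direct sums *)

Lemma nmulBl (K : pzRingType) (A : nuAlgType K) (x y z : A) :
  (x - y) ** z = x ** z - y ** z.
Proof. by rewrite nmulDl -scaleN1r nmulZl scaleN1r. Qed.

Lemma nmulBr (K : pzRingType) (A : nuAlgType K) (x y z : A) :
  z ** (x - y) = z ** x - z ** y.
Proof. by rewrite nmulDr -scaleN1r nmulZr scaleN1r. Qed.

Lemma nmul3A (K : pzRingType) (A : nuAlgType K) (a b c d : A) :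
  a ** (b ** c ** d) = a ** b ** c ** d.
Proof. by rewrite !nmulA. Qed.

Section DsumLift.
Variables (K : pzRingType) (I : choiceType) (V : I -> lmodType K).

Definition delta_fun i (r : V i) : forall j, V j :=
  fun j => if pselect (i = j) is left ij then ecast j (V j) ij r else 0.

Fact delta_finite i (r : V i) : finite_set [set j | delta_fun r j != 0].
Proof.
apply: (sub_finite_set _ (finite_set1 i)) => j /=.
by rewrite /delta_fun; case: pselect => [ij _|_]; [exact/esym|rewrite eqxx].
Qed.
Definition delta i (r : V i) : dsum V := Dsum (delta_finite r).

Lemma delta_same i (r : V i) : delta r i = r.
Proof.
by rewrite /= /delta_fun; case: pselect => // e; rewrite (Prop_irrelevance e erefl).
Qed.

Lemma delta_diff i j (r : V i) : i <> j -> delta r j = 0.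
Proof. by rewrite /= /delta_fun; case: pselect. Qed.

(** Induction on a list that contains the support: subtracting [delta (f i)] removes [i] from it. *)
Lemma dsum_ind (P : dsum V -> Prop) :
  (forall f g, P f -> P g -> P (f + g)) ->
  (forall i (r : V i), P (delta r)) -> P 0 -> forall f, P f.
Proof.
move=> PD Pdelta P0 f.
have /finite_seqP[s fs] := dsum_finite f.
have {}fs : forall i, f i != 0 -> i \in s.
  by move=> i fi; have : [set i | f i != 0] i by []; rewrite fs.
elim: s f fs => [|i s IH] f fs.
  suff -> : f = 0 by [].
  by apply: dsumP => j; apply/eqP/negPn/negP => /fs.
have -> : f = delta (f i) + (f - delta (f i)) by rewrite addrC subrK.
apply: PD => //; apply: IH => j.
have [<-|ij] := pselect (i = j).
  by rewrite dsumDE [_ i in X in _ + X](_ : _ = - delta (f i) i)// delta_same subrr eqxx.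
rewrite dsumDE [_ j in X in _ + X](_ : _ = - delta (f i) j)// delta_diff// subr0.
by move/fs; rewrite inE => /orP[/eqP ji|//]; rewrite ji in ij.
Qed.

Variables (W : lmodType K) (phi : forall i, {linear V i -> W}).

(** The map given by the universal property of the direct sum. *)
Definition dsum_lift (f : dsum V) : W := \sum_(i \in [set: I]) phi i (f i).

Lemma dsum_liftE (f : dsum V) (S : set I) : finite_set S ->
  (forall i, f i <> 0 -> S i) -> dsum_lift f = \sum_(i <- fset_set S) phi i (f i).
Proof.
move=> Sfin fS; apply: fsumTE => // i pfi; apply: fS.
by apply: contra_not pfi => ->; rewrite linear0.
Qed.

Fact dsum_lift_linear : linear dsum_lift.
Proof.
move=> k f g.
have fin : finite_set ([set i | f i != 0] `|` [set i | g i != 0]).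
  by rewrite finite_setU; split; exact: dsum_finite.
rewrite (@dsum_liftE (k *: f + g) _ fin); last first.
  move=> i; rewrite dsumDE dsumZE /=.
  have [-> |] := eqVneq (f i) 0; last by left.
  by rewrite scaler0 add0r => /eqP; right.
rewrite (@dsum_liftE f _ fin); last by move=> i /eqP; left.
rewrite (@dsum_liftE g _ fin); last by move=> i /eqP; right.
rewrite scaler_sumr -big_split /=; apply: eq_bigr => i _.
by rewrite linearP.
Qed.

HB.instance Definition _ := GRing.isLinear.Build K (dsum V) W _ dsum_lift
  dsum_lift_linear.

Lemma dsum_lift_delta i (r : V i) : dsum_lift (delta r) = phi i r.
Proof.
rewrite (dsum_liftE (finite_set1 i)); last first.
  by move=> j; have [->//|ij] := pselect (j = i); rewrite delta_diff// => /esym.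
by rewrite fset_set1 big_seq_fset1 delta_same.
Qed.

(** The tool for injectivity of lifts: an additive map that kills all terms but the [i]-th reads off
    the coordinate [f i]. *)
Lemma dsum_lift_coord (T : zmodType) (kappa : {additive W -> T}) (f : dsum V) i :
  (forall j, j <> i -> kappa (phi j (f j)) = 0) ->
  kappa (dsum_lift f) = kappa (phi i (f i)).
Proof.
move=> kj.
have fin : finite_set ([set j | f j != 0] `|` [set i]).
  by rewrite finite_setU; split => //; exact: dsum_finite.
rewrite (dsum_liftE fin); last by move=> j /eqP; left.
have iS : i \in fset_set ([set j | f j != 0] `|` [set i]).
  by rewrite in_fset_set// inE; right.
rewrite raddf_sum (big_fsetD1 i)//= [X in _ + X]big_seq big1 ?addr0// => j.
by rewrite !inE => /andP[/eqP ji _]; exact: kj.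
Qed.

End DsumLift.

Lemma dsum_nmulE (K : pzRingType) (I : Type) (A : I -> nuAlgType K)
  (f g : dsum A) i : (f ** g) i = f i ** g i.
Proof. by []. Qed.

(** * Algebras embedded as ideals, and sums of orthogonal ideals *)

Section Embeddings.
Variables (K : pzRingType).

(** An isomorphism of [B] onto [J], expressed inside [A] so that ideals can be added without passing
    to their subtypes. *)
Definition embeds (B A : nuAlgType K) (J : set A) : Prop :=
  exists f : {linear B -> A}, [/\ injective f,
    forall x y, f (x ** y) = f x ** f y & range f = J].

Lemma embeds_iso (A B : nuAlgType K) (J : ideal A) :
  embeds B (J : set A) -> nualg_iso (ideal_sort J) B.
Proof.
move=> [f [finj fM fJ]].
have Jex (x : ideal_sort J) : exists b, f b = \val x.
  have : (J : set A) (\val x) by apply/asboolP; exact: (valP x).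
  by rewrite -fJ => -[b _ <-]; exists b.
pose g x := projT1 (cid (Jex x)).
have gK x : f (g x) = \val x by rewrite /g; case: cid.
have glin : linear g.
  by move=> k x y; apply: finj; rewrite linearP !gK.
pose gL : {linear ideal_sort J -> B} := HB.pack g
  (GRing.isLinear.Build K (ideal_sort J) B _ g glin).
exists gL; split.
  have Jf b : ideal_pred J (f b) by apply/asboolP; rewrite -fJ; exists b.
  exists (fun b => exist _ (f b) (Jf b)) => [x|b].
    by apply: val_inj; rewrite /= gK.
  by apply: finj; rewrite gK.
by move=> x y; apply: finj; rewrite fM !gK.
Qed.

Lemma embeds_ideal_sort (A : nuAlgType K) (J : ideal A) :
  embeds (ideal_sort J) (J : set A).
Proof.
pose f (x : ideal_sort J) : A := \val x.
have flin : linear f by move=> k x y; rewrite /f linearP.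
pose fL : {linear ideal_sort J -> A} := HB.pack f
  (GRing.isLinear.Build K (ideal_sort J) A _ f flin).
exists fL; split => [x y /val_inj|x y|] //.
apply/seteqP; split => [_ [x _ <-]|x Jx]; first by apply/asboolP; exact: (valP x).
by have Jx' : ideal_pred J x by [apply/asboolP]; exists (exist _ x Jx').
Qed.

(** Orthogonality makes [f + g] multiplicative. It is injective because, in a relation
    [f x1 + g x2 = 0], right multiplication by [J2] kills the first term, so that [g x2] annihilates
    [J2] and is zero by the last hypothesis. *)
Lemma embeds_pair (A B1 B2 : nuAlgType K) (J1 J2 : ideal A) :
  embeds B1 (J1 : set A) -> embeds B2 (J2 : set A) ->
  (forall x y, (J1 : set A) x -> (J2 : set A) y -> x ** y = 0 /\ y ** x = 0) ->
  (forall x, (J2 : set A) x -> (forall y, (J2 : set A) y -> x ** y = 0) -> x = 0) ->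
  embeds (B1 * B2)%type (ideal_add J1 J2 : set A).
Proof.
move=> [f [finj fM fJ]] [g [ginj gM gJ]] orth nondeg.
have Jf x : (J1 : set A) (f x) by rewrite -fJ; exists x.
have Jg x : (J2 : set A) (g x) by rewrite -gJ; exists x.
pose h (x : B1 * B2) : A := f x.1 + g x.2.
have hlin : linear h.
  by move=> k x y; rewrite /h /= !linearP scalerDr addrACA.
pose hL : {linear (B1 * B2)%type -> A} := HB.pack h
  (GRing.isLinear.Build K (B1 * B2)%type A _ h hlin).
exists hL; split.
- suff h0 x : h x = 0 -> x = 0.
    by move=> x y /eqP; rewrite -subr_eq0 -linearB => /eqP/h0/eqP; rewrite subr_eq0 => /eqP.
  case: x => x1 x2; rewrite /h /= => fg0.
  have g0 : g x2 = 0.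
    apply: nondeg => // y J2y.
    by have := congr1 (nmul^~ y) fg0; rewrite nmulDl (orth _ _ (Jf x1) J2y).1 nmul0 add0r.
  have x20 : x2 = 0 by apply: ginj; rewrite g0 linear0.
  move: fg0; rewrite g0 addr0 => f0; rewrite x20.
  by have -> : x1 = 0 by apply: finj; rewrite f0 linear0.
- move=> [x1 x2] [y1 y2]; rewrite /= /h /= fM gM nmulDl !nmulDr.
  by rewrite (orth _ _ (Jf x1) (Jg y2)).1 (orth _ _ (Jf y1) (Jg x2)).2 addr0 add0r.
- apply/seteqP; split => [_ [x _ <-]|_ [x J1x [y J2y <-]]].
    by exists (f x.1) => //; exists (g x.2).
  move: J1x J2y; rewrite -fJ -gJ => -[a _ <-] [b _ <-].
  by exists (a, b).
Qed.

Lemma embeds_dsum (A : nuAlgType K) (I : choiceType) (B : I -> nuAlgType K)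
    (J : I -> ideal A) :
  (forall i, embeds (B i) (J i : set A)) ->
  (forall i j x y, i <> j -> (J i : set A) x -> (J j : set A) y -> x ** y = 0) ->
  (forall i x, (J i : set A) x ->
     (forall y, (J i : set A) y -> x ** y = 0) -> x = 0) ->
  embeds (dsum B) (ideal_gen (\bigcup_(i in [set: I]) (J i : set A)) : set A).
Proof.
move=> emb orth nondeg.
pose f i := projT1 (cid (emb i)).
have finj i : injective (f i) by rewrite /f; case: cid => ? [].
have fM i x y : f i (x ** y) = f i x ** f i y by rewrite /f; case: cid => ? [].
have fJ i : range (f i) = J i by rewrite /f; case: cid => ? [].
have Jf i x : (J i : set A) (f i x) by rewrite -fJ; exists x.
exists (dsum_lift f : {linear dsum B -> A}); split.
- suff h0 (x : dsum B) : dsum_lift f x = 0 -> x = 0.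
    move=> x y /eqP; rewrite -subr_eq0 -linearB => /eqP/h0/eqP.
    by rewrite subr_eq0 => /eqP.
  move=> x0; apply: dsumP => i; apply: finj; rewrite linear0.
  apply: nondeg => // y Jy.
  (* Right multiplication by an element of [J i] kills every summand but the [i]-th. *)
  pose k (a : A) := a ** y.
  have kadd : zmod_morphism k by move=> a b; rewrite /k nmulBl.
  pose kL : {additive A -> A} := HB.pack k (GRing.isZmodMorphism.Build A A k kadd).
  suff : kL (dsum_lift f x) = kL (f i (x i)) by rewrite x0 raddf0.
  by apply: dsum_lift_coord => j ji; exact: orth ji _ _.
- move=> /= x y; elim/dsum_ind: x => [x x' IH IH'|i r|]; last first.
  + by rewrite nmul0 linear0 nmul0.
  + elim/dsum_ind: y => [y y' IH IH'|j s|]; last first.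
    * by rewrite nmulr0 linear0 nmulr0.
    * rewrite !dsum_lift_delta; have [ij|ij] := pselect (i = j).
        case: _ / ij s => s.
        rewrite -fM -(dsum_lift_delta f); congr (dsum_lift _ _).
        apply: dsumP => k; rewrite dsum_nmulE.
        have [<-|ik] := pselect (i = k); first by rewrite !delta_same.
        by rewrite !delta_diff// nmul0.
      rewrite (orth _ _ _ _ ij)// -[RHS](linear0 (dsum_lift f)); congr (dsum_lift _ _).
      apply: dsumP => k; rewrite dsum_nmulE.
      have [ik|ik] := pselect (i = k); last by rewrite delta_diff// nmul0.
      by rewrite (@delta_diff _ _ _ j) ?nmulr0// -ik => /esym.
    * by rewrite nmulDr !linearD /= IH IH' nmulDr.
  + by rewrite nmulDl !linearD /= IH IH' nmulDl.
- apply/seteqP; split => [_ [x _ <-] S [Sid SJ]|].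
    elim/dsum_ind: x => [x x' IH IH'|i r|].
    + by rewrite linearD; exact: is_idealD.
    + by rewrite /= dsum_lift_delta; apply: SJ; exists i.
    + by rewrite linear0; exact: is_ideal0.
  have lift_range i x : (J i : set A) x -> range (dsum_lift f) x.
    by rewrite -fJ => -[r _ <-]; exists (delta r) => //; rewrite dsum_lift_delta.
  have lift0 : range (dsum_lift f) 0 by exists 0 => //; rewrite linear0.
  have liftD x y : range (dsum_lift f) x -> range (dsum_lift f) y ->
      range (dsum_lift f) (x + y).
    by move=> [a _ <-] [b _ <-]; exists (a + b) => //; rewrite linearD.
  apply: smallest_sub; last by move=> x [i _ Jx]; exact: lift_range Jx.
  split=> //.
  + by move=> k _ [a _ <-]; exists (k *: a) => //; rewrite linearZ.
  + move=> a _ [x _ <-]; elim/dsum_ind: x => [x x' IH IH'|i r|].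
    * by rewrite linearD nmulDr; exact: liftD.
    * by rewrite /= dsum_lift_delta; apply: (lift_range i); apply: is_idealMl; [exact: idealP|].
    * by rewrite linear0 nmulr0.
  + move=> a _ [x _ <-]; elim/dsum_ind: x => [x x' IH IH'|i r|].
    * by rewrite linearD nmulDl; exact: liftD.
    * by rewrite /= dsum_lift_delta; apply: (lift_range i); apply: is_idealMr; [exact: idealP|].
    * by rewrite linear0 nmul0.
Qed.

End Embeddings.

(** * Generators of the Leavitt path algebra *)

Section Presentation.
Variables (K : fieldType) (E : digraph).
Local Notation L := (leavitt K E).
Implicit Types (u v w : vertex E) (e f : edge E) (p q z : seq (edge E)).

Definition vtx v : L := lclass (LVertex K v).
Definition edg e : L := lclass (LEdge K e).
Definition gho e : L := lclass (LGhost K e).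

Lemma lclassD (x y : lterm K E) : lclass (LAdd x y) = lclass x + lclass y.
Proof. by rewrite -leavitt_addE. Qed.
Lemma lclassZ k (x : lterm K E) : lclass (LScale k x) = k *: lclass x.
Proof. by rewrite -leavitt_scaleE. Qed.
Lemma lclassM (x y : lterm K E) : lclass (LMul x y) = lclass x ** lclass y.
Proof. by rewrite -leavitt_mulE. Qed.

Lemma vtxM v w : vtx v ** vtx w = if v == w then vtx v else 0.
Proof.
rewrite -lclassM; have /lclassP -> := lrel_vertex K v w.
by case: eqP.
Qed.

Lemma vtxMM v : vtx v ** vtx v = vtx v.
Proof. by rewrite vtxM eqxx. Qed.

Lemma source_edg e : vtx (source e) ** edg e = edg e.
Proof. by rewrite -lclassM; apply/lclassP/lrel_source. Qed.
Lemma edg_target e : edg e ** vtx (target e) = edg e.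
Proof. by rewrite -lclassM; apply/lclassP/lrel_target. Qed.
Lemma target_gho e : vtx (target e) ** gho e = gho e.
Proof. by rewrite -lclassM; apply/lclassP/lrel_ghost_target. Qed.
Lemma gho_source e : gho e ** vtx (source e) = gho e.
Proof. by rewrite -lclassM; apply/lclassP/lrel_ghost_source. Qed.

Lemma gho_edg e f : gho e ** edg f = if e == f then vtx (target e) else 0.
Proof.
rewrite -lclassM; have /lclassP -> := lrel_CK1 K e f.
by case: eqP.
Qed.

Lemma CK2 v : regular v ->
  vtx v = \sum_(e <- fset_set (emitted v)) edg e ** gho e.
Proof.
move=> /(lrel_CK2 K)/lclassP; rewrite -/(vtx v) => ->.
elim/big_rec2: _ => [|e x y _ <-]; first by [].
by rewrite lclassD lclassM.
Qed.

Lemma leavitt_ind (P : L -> Prop) :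
  P 0 -> (forall v, P (vtx v)) -> (forall e, P (edg e)) ->
  (forall e, P (gho e)) -> (forall x y, P x -> P y -> P (x + y)) ->
  (forall k x, P x -> P (k *: x)) -> (forall x y, P x -> P y -> P (x ** y)) ->
  forall x, P x.
Proof.
move=> P0 Pv Pe Pg PD PZ PM; elim/lclass_ind.
elim=> [|v|e|e|x Px y Py|k x Px|x Px y Py].
- exact: P0.
- exact: Pv.
- exact: Pe.
- exact: Pg.
- by rewrite lclassD; exact: PD.
- by rewrite lclassZ; exact: PZ.
- by rewrite lclassM; exact: PM.
Qed.

(** The standard involution, defined on terms before passing to the quotient. It transfers
    statements about left multiplication to right multiplication. *)
Fixpoint tstar (x : lterm K E) : lterm K E :=
  match x with
  | LZero => LZero K E
  | LVertex v => LVertex K v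
  | LEdge e => LGhost K e
  | LGhost e => LEdge K e
  | LAdd x y => LAdd (tstar x) (tstar y)
  | LScale k x => LScale k (tstar x)
  | LMul x y => LMul (tstar y) (tstar x)
  end.

Lemma lrel_tstar x y : lrel x y -> lrel (tstar x) (tstar y).
Proof.
elim=> {x y} /=; try by [constructor|constructor; auto].
- by move=> x y z _ xy _; exact: lrel_trans.
- by move=> x y z; apply: lrel_sym; exact: lrel_mulA.
- move=> v w; rewrite (_ : tstar _ = if v == w then LVertex K v else LZero K E).
    by rewrite eq_sym; have := lrel_vertex K w v; case: eqP => // ->.
  by case: eqP.
- move=> e f; rewrite (_ : tstar _ = if e == f then LVertex K (target e) else LZero K E).
    by rewrite eq_sym; have := lrel_CK1 K f e; case: eqP => // ->.
  by case: eqP.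
- move=> v /(lrel_CK2 K) /=.
  by rewrite (big_morph tstar (id1 := LZero K E) (op1 := @LAdd K E)).
Qed.

Definition star (a : L) : L := lclass (tstar (repr a)).

Lemma starE x : star (lclass x) = lclass (tstar x).
Proof. by apply/lclassP/lrel_tstar/lrel_repr. Qed.

Lemma starK : involutive star.
Proof.
elim/lclass_ind => x; rewrite !starE; congr lclass.
by elim: x => //= [x -> y ->|k x ->|x -> y ->].
Qed.

Fact star_linear : linear star.
Proof.
move=> k; elim/lclass_ind => x; elim/lclass_ind => y.
by rewrite -lclassZ -lclassD !starE /= lclassD lclassZ.
Qed.
HB.instance Definition _ := GRing.isLinear.Build K L L _ star star_linear.

Lemma starM a b : star (a ** b) = star b ** star a.
Proof.
elim/lclass_ind: a => x; elim/lclass_ind: b => y.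
by rewrite -lclassM !starE /= lclassM.
Qed.

Lemma star_vtx v : star (vtx v) = vtx v. Proof. exact: starE. Qed.
Lemma star_edg e : star (edg e) = gho e. Proof. exact: starE. Qed.
End Presentation.

Arguments vtx K {E} v.
Arguments edg K {E} e.
Arguments gho K {E} e.

(** * Linear independence of real paths *)

Section Representation.
Variables (K : fieldType) (E : digraph).
Implicit Types (u v w : vertex E) (e f : edge E) (p q z : seq (edge E)).

(* The state [(u, (l, n), d)] lies over the vertex [u]. An edge [e] maps the states
   over its target injectively to those over its source, raising the degree [d]:
   it prepends [e] to [l] at an infinite emitter, and at a regular vertex with
   [k] edges it maps [n] to [n * k + i] if [e] is the [i]-th one, so that the
   images of the [k] edges form a partition. *)
Definition code : Type := seq (edge E) * nat.
Definition state : choiceType := (vertex E * (code * int))%type.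

Definition siblings e : seq (edge E) := fset_set (emitted (source e)).

Definition enc e (t : code) : code :=
  if `[< regular (source e) >]
  then (t.1, (t.2 * size (siblings e) + index e (siblings e))%N)
  else (e :: t.1, t.2).

(** The partial inverse of [enc e], with value [None] off its image. *)
Definition dec e (t : code) : option code :=
  if `[< regular (source e) >]
  then if (t.2 %% size (siblings e))%N == index e (siblings e)
       then Some (t.1, (t.2 %/ size (siblings e))%N) else None
  else if t.1 is f :: l then if f == e then Some (l, t.2) else None else None.

Lemma mem_siblings e : regular (source e) -> e \in siblings e.
Proof. by move=> [fin _]; rewrite /siblings in_fset_set// inE. Qed.

(** The edges leaving one vertex have injective encodings with disjoint images, which is what (CK1)
    requires. In the regular case this is uniqueness of quotient and remainder. *)
Lemma dec_enc e f t : source e = source f ->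
  dec e (enc f t) = if e == f then Some t else None.
Proof.
move=> ef; rewrite /dec /enc -ef; case: asboolP => [reg|_] /=; last first.
  by rewrite eq_sym; case: eqP => // _; case: t.
have eS := mem_siblings reg.
have fS : f \in siblings e by rewrite /siblings ef mem_siblings// -ef.
have <- : siblings e = siblings f by rewrite /siblings ef.
have lt : (index f (siblings e) < size (siblings e))%N by rewrite index_mem.
rewrite modnMDl modn_small//.
have -> : (index f (siblings e) == index e (siblings e)) = (e == f).
  by apply/eqP/eqP => [/esym|->//]; exact: index_inj.
by case: eqP => // _; rewrite divnMDl ?divn_small ?addn0//; [case: t|exact: leq_ltn_trans lt].
Qed.

Lemma decK e t t' : dec e t = Some t' -> enc e t' = t.
Proof.
rewrite /dec /enc; case: asboolP => [reg|_].
  case: eqP => // <- [<-] /=; rewrite -divn_eq; by case: t.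
case: t => -[//|f l] n /=; by case: eqP => // -> [<-].
Qed.

(** The images cover all codes, which is what (CK2) requires: the remainder of [t.2] gives the
    position of the edge. *)
Lemma dec_cover v t : regular v ->
  exists2 e, source e = v /\ e \in fset_set (emitted v) & dec e t != None.
Proof.
move=> reg; have [fin [e0 e0v]] := reg.
pose s : seq (edge E) := fset_set (emitted v).
have s0 : (0 < size s)%N.
  have : e0 \in s by rewrite /s in_fset_set// inE.
  by case: (s).
pose e := nth e0 s (t.2 %% size s).
have lt : (t.2 %% size s < size s)%N by rewrite ltn_mod.
have es : e \in s by exact: mem_nth.
have ev : source e = v by move: (es); rewrite /s in_fset_set// inE.
exists e; first by split.
rewrite /dec /siblings ev -/s asboolT//.
by rewrite /e index_uniq// ?eqxx//; exact: fset_uniq.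
Qed.

(** An edge pushes functions forward along its injection of states, extending by zero; a ghost edge
    pulls them back. Since arbitrary functions are allowed, no finiteness of supports has to be
    maintained. *)
Fixpoint ev (x : lterm K E) (g : state -> K) : state -> K :=
  match x with
  | LZero => fun=> 0
  | LVertex v => fun s => if s.1 == v then g s else 0
  | LEdge e => fun s =>
      if s.1 == source e then
        if dec e s.2.1 is Some t then g (target e, (t, s.2.2 - 1)) else 0
      else 0
  | LGhost e => fun s =>
      if s.1 == target e then g (source e, (enc e s.2.1, s.2.2 + 1)) else 0
  | LAdd x y => fun s => ev x g s + ev y g s
  | LScale k x => fun s => k * ev x g s
  | LMul x y => ev x (ev y g)
  end.

Lemma ev_linear x k g h :
  ev x (fun s => k * g s + h s) = fun s => k * ev x g s + ev x h s.
Proof.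
elim: x g h => [|v|e|e|x IHx y IHy|l x IHx|x IHx y IHy] g h /=;
  apply/funext => s; rewrite ?mulr0 ?addr0//.
- by case: eqP; rewrite ?mulr0 ?addr0.
- by case: eqP; rewrite ?mulr0 ?addr0//; case: dec => *; rewrite ?mulr0 ?addr0.
- by case: eqP; rewrite ?mulr0 ?addr0.
- by rewrite IHx IHy mulrDr addrACA.
- by rewrite IHx mulrDr mulrCA.
- by rewrite IHy IHx.
Qed.

Lemma ev_scale x k g : ev x (fun s => k * g s) = fun s => k * ev x g s.
Proof.
have ev0 : ev x (fun=> 0) = fun=> 0.
  elim: x => [|v|e|e|x IHx y IHy|l x IHx|x IHx y IHy] /=; apply/funext => s //.
  - by case: eqP.
  - by case: eqP => // _; case: dec.
  - by case: eqP.
  - by rewrite IHx IHy addr0.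
  - by rewrite IHx mulr0.
  - by rewrite IHy IHx.
have := ev_linear x k g (fun=> 0); rewrite ev0.
rewrite (_ : (fun s => k * g s + 0) = fun s => k * g s) => [->|].
  by apply/funext => s; rewrite addr0.
by apply/funext => s; rewrite addr0.
Qed.

Lemma ev_add x g h : ev x (fun s => g s + h s) = fun s => ev x g s + ev x h s.
Proof.
have := ev_linear x 1 g h.
rewrite (_ : (fun s => 1 * g s + h s) = fun s => g s + h s) => [->|].
  by apply/funext => s; rewrite mul1r.
by apply/funext => s; rewrite mul1r.
Qed.

Lemma lrel_ev x y : lrel x y -> forall g, ev x g = ev y g.
Proof.
elim=> {x y} /=.
- by [].
- by move=> x y _ xy g; rewrite xy.
- by move=> x y z _ xy _ yz g; rewrite xy yz.
- by move=> x x' y y' _ xx' _ yy' g; rewrite xx' yy'.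
- by move=> k x x' _ xx' g; rewrite xx'.
- by move=> x x' y y' _ xx' _ yy' g; rewrite xx' yy'.
- by move=> x y z g; apply/funext => s; rewrite addrA.
- by move=> x y g; apply/funext => s; rewrite addrC.
- by move=> x g; apply/funext => s; rewrite add0r.
- by move=> x g; apply/funext => s; rewrite mulN1r addNr.
- by move=> k l x g; apply/funext => s; rewrite mulrA.
- by move=> x g; apply/funext => s; rewrite mul1r.
- by move=> k x y g; apply/funext => s; rewrite mulrDr.
- by move=> k l x g; apply/funext => s; rewrite mulrDl.
- by [].
- by [].
- by move=> x y z g; rewrite ev_add.
- by [].
- by move=> k x y g; rewrite ev_scale.
- move=> v w g; apply/funext => s.
  have [->|vw] := eqVneq v w; first by rewrite /=; case: eqP.
  by rewrite /=; case: eqP => // ->; rewrite (negbTE vw).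
- by move=> e g; apply/funext => s; case: eqP.
- move=> e g; apply/funext => s; case: eqP => // _; case: dec => // t.
  by rewrite eqxx.
- by move=> e g; apply/funext => s; case: eqP.
- by move=> e g; apply/funext => s; rewrite eqxx.
- move=> e f g; apply/funext => -[u [t d]] /=.
  have [<-{f}|ef] := eqVneq e f => /=.
    by case: eqP => // ->; rewrite eqxx dec_enc// eqxx addrK.
  case: eqP => // _; case: eqP => // /esym sf.
  by rewrite dec_enc// eq_sym (negbTE ef).
- move=> v reg g; apply/funext => -[u [t d]] /=.
  have -> : ev (\big[@LAdd K E/LZero K E]_(e <- fset_set (emitted v))
      LMul (LEdge K e) (LGhost K e)) g (u, (t, d)) =
    \sum_(e <- fset_set (emitted v))
      ev (LMul (LEdge K e) (LGhost K e)) g (u, (t, d)).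
    by elim/big_rec2: _ => [//|e y x _ /= <-].
  have inS e : e \in fset_set (emitted v) -> source e = v.
    by rewrite in_fset_set ?inE; case: reg.
  have [->|uv] := eqVneq u v; last first.
    rewrite big_seq big1// => e /inS ev /=.
    by rewrite ev (negbTE uv).
  (* Exactly one edge decodes the state; its term returns the value of [g], and the other terms
     vanish. *)
  have [e [ev eS] et] := dec_cover t reg.
  rewrite (big_fsetD1 e)//=. rewrite ev eqxx; case dt : (dec e t) et => [t'|] // _.
  rewrite eqxx (decK dt) subrK big_seq big1 ?addr0// => f.
  rewrite !inE => /andP[fe /inS fv] /=; rewrite fv eqxx.
  have := dec_enc t' (etrans fv (esym ev)); rewrite (decK dt) (negbTE fe).
  by move=> ->.
Qed.

Local Notation L := (leavitt K E).

Definition act (a : L) (g : state -> K) : state -> K := ev (repr a) g.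

Lemma actE x g : act (lclass x) g = ev x g.
Proof. exact/lrel_ev/lrel_repr. Qed.

Lemma actM a b g : act (a ** b) g = act a (act b g).
Proof.
by elim/lclass_ind: a => x; elim/lclass_ind: b => y; rewrite -lclassM !actE.
Qed.

(** The end [w] is an argument because an empty path does not determine it. *)
Fixpoint pelt p w : L := if p is e :: p' then edg K e ** pelt p' w else vtx K w.

(** The image under [p] of a base state over [w]. *)
Fixpoint pstate p w : state :=
  if p is e :: p' then
    let s := pstate p' w in (source e, (enc e s.2.1, s.2.2 + 1))
  else (w, (([::], 0%N), 0)).

Lemma pstate_source u p w : is_path u p w -> (pstate p w).1 = u.
Proof. by case: p => [|e p] /= => [->|[]]. Qed.

Lemma pstate_size p w : (pstate p w).2.2 = (size p)%:Z.
Proof. by elim: p => //= e p ->; rewrite -PoszD addn1. Qed.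

Lemma act_pelt u p w : is_path u p w ->
  act (pelt p w) (fun s => (s == pstate [::] w)%:R) = fun s => (s == pstate p w)%:R.
Proof.
elim: p u => [|e p IH] u /=.
  move=> _; rewrite actE /=; apply/funext => s; case: eqP => // sw.
  by case: eqP => // es; rewrite es in sw.
move=> [_ pw]; rewrite actM (IH _ pw) actE; apply/funext => -[x [t d]] /=.
have ps := pstate_source pw.
move: ps; case: (pstate p w) => y [t' d'] /= ->; clear.
rewrite [RHS](_ : _ = ((x == source e) && ((t == enc e t') && (d == d' + 1)))%:R)//.
case: eqP => [_|//]; case dt : (dec e t) => [t0|].
  rewrite [LHS](_ : _ = ((target e == target e) && ((t0 == t') && (d - 1 == d')))%:R)//.
  rewrite eqxx /= subr_eq; congr ((_ && _)%:R); rewrite -(decK dt).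
  apply/eqP/eqP => [->//|] /(congr1 (dec e)); rewrite !dec_enc// eqxx.
  by move=> [].
have -> : (t == enc e t') = false; last by [].
by apply/eqP => tt'; move: dt; rewrite tt' dec_enc// eqxx.
Qed.

(** The edges are decoded one by one, and the degree tells an empty path from a nonempty one:
    without it, a loop that is the only edge at its vertex would fix the base state. *)
Lemma pstate_inj u u' p p' w : is_path u p w -> is_path u' p' w ->
  pstate p w = pstate p' w -> p = p'.
Proof.
elim: p p' u u' => [|e p IH] [|e' p'] u u' //=.
- by move=> _ _ []; rewrite pstate_size => _ _ /eqP; rewrite -PoszD addn1.
- by move=> _ _ []; rewrite pstate_size => _ _ /eqP; rewrite -PoszD addn1.
move=> [_ pw] [_ pw'] [ss ee /addIr dd].
have := dec_enc (pstate p w).2.1 (erefl (source e)).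
rewrite eqxx ee dec_enc//; case: eqP => // ee' [tt].
rewrite -ee' in pw'; rewrite -ee'; congr (_ :: _); apply: (IH _ _ _ pw pw').
rewrite [LHS]surjective_pairing [RHS]surjective_pairing.
rewrite (pstate_source pw) (pstate_source pw') [X in (_, X)]surjective_pairing.
by rewrite -tt dd -surjective_pairing.
Qed.

(** On combinations of real paths ending at [w] this is the coefficient of [p]; on other elements it
    is merely some linear functional. *)
Definition coef p w (a : L) : K^o :=
  act a (fun s => (s == pstate [::] w)%:R) (pstate p w).

Fact coef_linear p w : linear (coef p w).
Proof.
move=> k; elim/lclass_ind => x; elim/lclass_ind => y.
by rewrite -lclassZ -lclassD /coef !actE.
Qed.
HB.instance Definition _ p w :=
  GRing.isLinear.Build K L K^o _ (coef p w) (coef_linear p w).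

Lemma coef_pelt u p w u' p' : is_path u p w -> is_path u' p' w ->
  coef p w (pelt p' w) = (p == p')%:R.
Proof.
move=> pw pw'; rewrite /coef (act_pelt pw').
have -> // : (pstate p w == pstate p' w) = (p == p').
by apply/eqP/eqP => [|->//]; exact: pstate_inj pw pw'.
Qed.

End Representation.

Arguments pelt K {E} p w.

(** * Monomials and vertex ideals *)

Inductive spanned (K : pzRingType) (V : lmodType K) (S : set V) : V -> Prop :=
| spanned0 : spanned S 0
| spanned_gen x of S x : spanned S x
| spannedD x y of spanned S x & spanned S y : spanned S (x + y)
| spannedZ k x of spanned S x : spanned S (k *: x).

Section GraphPaths.
Variable E : digraph.
Implicit Types (u v w : vertex E) (e f : edge E) (p q z : seq (edge E)).

Lemma is_path_cat u p q w :
  is_path u (p ++ q) w <-> exists2 x, is_path u p x & is_path x q w.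
Proof.
elim: p u => [|e p IH] u /=.
  by split=> [pw|[x -> //]]; exists u.
split=> [[-> /IH[x px xw]]|[x [-> px] xw]]; first by exists x.
by split=> //; apply/IH; exists x.
Qed.

Lemma tree_refl v : tree v v. Proof. by exists [::]. Qed.

Lemma tree_trans v w x : tree v w -> tree w x -> tree v x.
Proof.
by move=> [p vw] [q wx]; exists (p ++ q); apply/is_path_cat; exists w.
Qed.

Lemma tree_target v e : tree v (source e) -> tree v (target e).
Proof. by move/tree_trans; apply; exists [:: e]. Qed.

Lemma is_path_end u p w w' : is_path u p w -> is_path u p w' -> w = w'.
Proof. by elim: p u => [|e p IH] u /= => [<- //|[_ pw] [_ pw']]; exact: IH pw pw'. Qed.

End GraphPaths.

Section PathElements.
Variables (K : fieldType) (E : digraph).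
Implicit Types (u v w : vertex E) (e f : edge E) (p q z : seq (edge E)).
Local Notation L := (leavitt K E).
Local Notation vtx := (vtx K).
Local Notation edg := (edg K).
Local Notation gho := (gho K).
Local Notation pelt := (pelt K).

Definition gelt p w : L := star (pelt p w).

Lemma star_pelt p w : star (pelt p w) = gelt p w. Proof. by []. Qed.
Lemma star_gelt p w : star (gelt p w) = pelt p w. Proof. exact: starK. Qed.

Lemma gelt_nil w : gelt [::] w = vtx w. Proof. exact: star_vtx. Qed.
Lemma gelt_cons e p w : gelt (e :: p) w = gelt p w ** gho e.
Proof. by rewrite /gelt /= starM star_edg. Qed.

Lemma source_pelt u p w : is_path u p w -> vtx u ** pelt p w = pelt p w.
Proof.
by case: p => [|e p] /= => [->|[<- _]]; rewrite ?vtxMM// nmulA source_edg.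
Qed.

Lemma pelt_target p w : pelt p w ** vtx w = pelt p w.
Proof. by elim: p => [|e p IH] /=; rewrite ?vtxMM// -nmulA IH. Qed.

Lemma gelt_source u p w : is_path u p w -> gelt p w ** vtx u = gelt p w.
Proof. by move/source_pelt=> up; rewrite /gelt -{2}up starM star_vtx. Qed.

Lemma target_gelt p w : vtx w ** gelt p w = gelt p w.
Proof. by rewrite /gelt -{2}(pelt_target p w) starM star_vtx. Qed.

Lemma pelt_cat p q w x : is_path x q w -> pelt (p ++ q) w = pelt p x ** pelt q w.
Proof.
move=> qw; elim: p => [|e p IH] /=; first by rewrite (source_pelt qw).
by rewrite IH nmulA.
Qed.

Lemma gelt_cat p q w x : is_path x q w -> gelt (p ++ q) w = gelt q w ** gelt p x.
Proof. by move=> qw; rewrite /gelt (pelt_cat _ qw) starM. Qed.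

Lemma gelt_pelt u p w : is_path u p w -> gelt p w ** pelt p w = vtx w.
Proof.
elim: p u => [|e p IH] u /=; first by rewrite gelt_nil vtxMM.
move=> [_ pw]; rewrite gelt_cons -nmulA [gho e ** _]nmulA gho_edg eqxx.
by rewrite (source_pelt pw) (IH _ pw).
Qed.

Lemma vtx_pelt0 v u p w : is_path u p w -> v <> u -> vtx v ** pelt p w = 0.
Proof.
by move=> /source_pelt <- /eqP vu; rewrite nmulA vtxM (negbTE vu) nmul0.
Qed.

Lemma gelt_vtx0 v u p w : is_path u p w -> v <> u -> gelt p w ** vtx v = 0.
Proof.
move=> pw vu; rewrite -(star_vtx K v) -starM (vtx_pelt0 pw vu).
exact: linear0.
Qed.

(** Equal first edges cancel by (CK1) and different ones give zero, so a nonzero product needs one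
    path to be a prefix of the other; what remains of the longer path survives. *)
Lemma gelt_pelt_cases u p w u' q w' : is_path u p w -> is_path u' q w' ->
  [\/ exists2 z, q = p ++ z & is_path w z w' /\ gelt p w ** pelt q w' = pelt z w',
      exists2 z, p = q ++ z & is_path w' z w /\ gelt p w ** pelt q w' = gelt z w |
      gelt p w ** pelt q w' = 0].
Proof.
elim: p q u u' => [|e p IH] q u u' /=.
  move=> <- {w}qw'; have [->|/eqP uu'] := eqVneq u u'.
    by constructor 1; exists q => //; rewrite gelt_nil (source_pelt qw').
  by constructor 3; rewrite gelt_nil (vtx_pelt0 qw').
case: q => [|f q] /=.
  move=> [_ pw] <-; have [eu'|/eqP eu'] := eqVneq u' (source e).
    constructor 2; exists (e :: p) => //; split; first by split.
    by rewrite gelt_cons -nmulA eu' gho_source.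
  constructor 3; rewrite gelt_cons -nmulA -(gho_source K e) -nmulA vtxM eq_sym.
  by case: eqP => [/esym//|]; rewrite !nmulr0.
move=> [_ pw] [_ qw']; rewrite gelt_cons -nmulA [gho e ** _]nmulA gho_edg.
have [ef|_] := eqVneq e f; last by constructor 3; rewrite nmul0 nmulr0.
rewrite {}ef in pw *; rewrite (source_pelt qw').
case: (IH _ _ _ pw qw') => [[z -> [zw zE]]|[z -> [zw zE]]|zE].
- by constructor 1; exists z.
- by constructor 2; exists z.
- by constructor 3.
Qed.

Definition monomials : set L :=
  [set x | exists u p w u' q,
     [/\ is_path u p w, is_path u' q w & x = pelt p w ** gelt q w]].

(** For the induction to pass through products, the claim is strengthened: left multiplication by
    [x] also preserves the span. *)
Lemma leavitt_spanned (x : L) : spanned monomials x.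
Proof.
have P_vtx u w p : is_path u p w -> spanned monomials (pelt p w).
  move=> pw; apply: spanned_gen; exists u, p, w, w, [::].
  by rewrite gelt_nil pelt_target.
have P_gho u w p : is_path u p w -> spanned monomials (gelt p w).
  move=> pw; apply: spanned_gen; exists w, [::], w, u, p.
  by rewrite /= target_gelt.
suff [] : spanned monomials x /\
    forall y, spanned monomials y -> spanned monomials (x ** y) by [].
(* For a generator [a] only its products with real paths have to be computed. *)
have gen (a : L) : spanned monomials a ->
    (forall u p w, is_path u p w -> a ** pelt p w = 0 \/
       spanned monomials (a ** pelt p w) /\
       forall u' q, is_path u' q w -> spanned monomials (a ** pelt p w ** gelt q w)) ->
    spanned monomials a /\
    forall y, spanned monomials y -> spanned monomials (a ** y).
  move=> sa ap; split=> // y.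
  elim=> [|_ [u [p [w [u' [q [pw qw ->]]]]]]|y1 y2 _ s1 _ s2|k y1 _ s1].
  - by rewrite nmulr0; exact: spanned0.
  - case: (ap _ _ _ pw) => [ap0|[_ ap1]]; first by rewrite nmulA ap0 nmul0; exact: spanned0.
    by rewrite nmulA; exact: ap1 qw.
  - by rewrite nmulDr; exact: spannedD.
  - by rewrite nmulZr; exact: spannedZ.
elim/leavitt_ind: x.
- by split=> [|y _]; rewrite ?nmul0; exact: spanned0.
- move=> v; apply: gen; first exact: (P_vtx v v [::]).
  move=> u p w pw; have [->|/eqP vu] := eqVneq v u; last by left; rewrite (vtx_pelt0 pw).
  right; rewrite (source_pelt pw); split=> [|u' q qw]; first exact: P_vtx pw.
  by apply: spanned_gen; exists u, p, w, u', q.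
- move=> e; apply: gen.
    rewrite -(edg_target K e); exact: (P_vtx (source e) (target e) [:: e]).
  move=> u p w pw; have [eu|/eqP eu] := eqVneq (target e) u; last first.
    by left; rewrite -edg_target -nmulA (vtx_pelt0 pw)// nmulr0.
  have epw : is_path (source e) (e :: p) w by rewrite /= eu.
  right; split=> [|u' q qw]; first exact: P_vtx epw.
  by apply: spanned_gen; exists (source e), (e :: p), w, u', q.
- move=> e.
  have epw : is_path (source e) [:: e] (target e) by [].
  have ge : gelt [:: e] (target e) = gho e by rewrite gelt_cons gelt_nil target_gho.
  rewrite -ge; apply: gen; first exact: P_gho epw.
  move=> u p w pw; case: (gelt_pelt_cases epw pw) => [[z _ [zw ->]]|[z _ [zw ->]]|->].
  + right; split=> [|u' q qw]; first exact: P_vtx zw.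
    by apply: spanned_gen; exists (target e), z, w, u', q.
  + right; split=> [|u' q qw]; first exact: P_gho zw.
    rewrite -(gelt_cat _ zw); apply: (P_gho u').
    by apply/is_path_cat; exists w.
  + by left.
- move=> x1 x2 [s1 m1] [s2 m2]; split=> [|y sy]; first exact: spannedD.
  by rewrite nmulDl; apply: spannedD; [exact: m1|exact: m2].
- move=> k x1 [s1 m1]; split=> [|y sy]; first exact: spannedZ.
  by rewrite nmulZl; apply: spannedZ; exact: m1.
- move=> x1 x2 [s1 m1] [s2 m2]; split=> [|y sy]; first exact: m1.
  by rewrite -nmulA; apply: m1; exact: m2.
Qed.

Lemma spanned_mono (S T : set L) : S `<=` T -> spanned S `<=` spanned T.
Proof.
move=> ST x; elim=> [|y Sy|y z _ Ty _ Tz|k y _ Ty].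
- exact: spanned0.
- by apply: spanned_gen; exact: ST.
- exact: spannedD.
- exact: spannedZ.
Qed.

Definition proj (t : seq (edge E) * vertex E) : L := pelt t.1 t.2 ** gelt t.1 t.2.

(** For comparable paths both products are the idempotent of the longer path, and for incomparable
    ones both vanish. *)
Lemma proj_comm u p w u' q w' : is_path u p w -> is_path u' q w' ->
  proj (p, w) ** proj (q, w') = proj (q, w') ** proj (p, w).
Proof.
move=> pw qw'; rewrite /proj /= !nmulA -![pelt _ _ ** gelt _ _ ** pelt _ _]nmulA.
have -> : gelt q w' ** pelt p w = star (gelt p w ** pelt q w').
  by rewrite starM star_gelt star_pelt.
case: (gelt_pelt_cases pw qw') => [[z qE [zw' ->]]|[z pE [zw ->]]|->].
- rewrite star_pelt -(pelt_cat _ zw') -qE.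
  by rewrite -[RHS]nmulA -(gelt_cat _ zw') -qE.
- rewrite star_gelt -(pelt_cat _ zw) -pE.
  by rewrite -[LHS]nmulA -(gelt_cat _ zw) -pE.
- by rewrite linear0 !nmulr0 !nmul0.
Qed.

Definition ghost_multiples (Q : set (seq (edge E) * vertex E)) : set L :=
  [set x | exists a u q w, [/\ Q (q, w), is_path u q w & x = a ** gelt q w]].

(* The operators [y |-> y - y ** proj t] commute, and a suitable product of them
   kills [y], while each of them fixes [y]. *)
Lemma ghost_span_eq0 Q (y : L) : spanned (ghost_multiples Q) y ->
  (forall q w, Q (q, w) -> y ** pelt q w = 0) -> y = 0.
Proof.
move=> sy yQ.
pose cut (t : seq (edge E) * vertex E) (x : L) := x - x ** proj t.
pose valid (t : seq (edge E) * vertex E) := Q t /\ exists u, is_path u t.1 t.2.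
pose cuts s x := foldr cut x s.
have cuts0 s : cuts s 0 = 0 by elim: s => //= t s ->; rewrite /cut nmul0 subr0.
have cutsD s x1 x2 : cuts s (x1 + x2) = cuts s x1 + cuts s x2.
  by elim: s => //= t s ->; rewrite /cut nmulDl opprD addrACA.
have cutsZ s k x : cuts s (k *: x) = k *: cuts s x.
  by elim: s => //= t s ->; rewrite /cut nmulZl scalerBr.
have cutC t t' x : valid t -> valid t' -> cut t (cut t' x) = cut t' (cut t x).
  case: t t' => [p w] [q w'] [_ [u /= pw]] [_ [u' /= qw']].
  rewrite /cut !nmulBl -[_ ** proj (q, w') ** _]nmulA -[_ ** proj (p, w) ** _]nmulA.
  rewrite (proj_comm qw' pw) !opprB !addrA.
  by rewrite [LHS]addrAC [RHS]addrAC; congr (_ + _); exact: addrAC.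
have cutsC s s' x : (forall t, t \in s -> valid t) -> (forall t, t \in s' -> valid t) ->
    cuts s (cuts s' x) = cuts s' (cuts s x).
  elim: s => //= t s IH vs vs'.
  rewrite IH//; last by move=> t' ts; apply: vs; rewrite inE ts orbT.
  have vt : valid t by apply: vs; rewrite inE eqxx.
  elim: s' vs' {IH} => //= t' s' IH vs'.
  rewrite cutC// ?IH//; first by move=> t0 ts; apply: vs'; rewrite inE ts orbT.
  by apply: vs'; rewrite inE eqxx.
have [s vs sy0] : exists2 s, (forall t, t \in s -> valid t) & cuts s y = 0.
  elim: sy {yQ} => [|_ [a [u [q [w [Qq qw ->]]]]]|y1 y2 _ [s1 v1 e1] _ [s2 v2 e2]
    |k y1 _ [s1 v1 e1]].
  - by exists [::].
  - exists [:: (q, w)]; first by move=> t; rewrite inE => /eqP ->; split=> //; exists u.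
    rewrite /= /cut /proj /= nmulA -[a ** _ ** _]nmulA (gelt_pelt qw) -nmulA.
    by rewrite target_gelt subrr.
  - exists (s1 ++ s2); first by move=> t; rewrite mem_cat => /orP[/v1|/v2].
    rewrite /cuts foldr_cat -/(cuts s2 _) -/(cuts s1 _) cutsD e2 addr0 cutsC// e1.
    exact: cuts0.
  - by exists s1 => //; rewrite cutsZ e1 scaler0.
rewrite -sy0; elim: s vs {sy0} => //= -[q w] s IH vs.
rewrite -IH; last by move=> t ts; apply: vs; rewrite inE ts orbT.
have [Qq _] : valid (q, w) by apply: vs; rewrite inE eqxx.
by rewrite /cut /proj /= nmulA yQ// nmul0 subr0.
Qed.

(** A path [p] from [u] to [v] gives [v = p^* u p]. *)
Lemma vertex_ideal_vtx (Y : set (vertex E)) v :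
  trees Y v -> (vertex_ideal K Y : set L) (vtx v).
Proof.
move=> [u Yu [p pv]].
have id := idealP (vertex_ideal K Y).
rewrite -(gelt_pelt pv) -(source_pelt pv).
apply: (is_idealMl id); apply: (is_idealMr id).
by move=> J [_]; apply; exists u.
Qed.

Lemma vertex_ideal_min (Y : set (vertex E)) (J : set L) :
  is_ideal J -> (forall v, Y v -> J (vtx v)) -> (vertex_ideal K Y : set L) `<=` J.
Proof. by move=> Jid JY x /(_ J); apply; split=> // _ [v Yv <-]; exact: JY. Qed.

(** The span is stable under right multiplication: in [q^* p'], either a real path out of the end of
    [q] remains, whose end is still in [trees Y], or a ghost path with the same end as [q]
    remains. *)
Lemma vertex_ideal_span (Y : set (vertex E)) :
  (vertex_ideal K Y : set L) `<=` spanned (ghost_multiples [set t | trees Y t.2]).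
Proof.
apply: vertex_ideal_min; last first.
  move=> v Yv; apply: spanned_gen; exists (vtx v), v, [::], v; split=> //.
    by exists v => //; exact: tree_refl.
  by rewrite gelt_nil vtxMM.
split.
- exact: spanned0.
- by move=> x y; exact: spannedD.
- by move=> k x; exact: spannedZ.
- move=> a x; elim=> [|_ [b [u [q [w [Qq qw ->]]]]]|y z _ Ty _ Tz|k y _ Ty].
  + by rewrite nmulr0; exact: spanned0.
  + by apply: spanned_gen; exists (a ** b), u, q, w; rewrite nmulA.
  + by rewrite nmulDr; exact: spannedD.
  + by rewrite nmulZr; exact: spannedZ.
- move=> a x; elim=> [|_ [b [u [q [w [/= Qw qw ->]]]]]|y z _ Ty _ Tz|k y _ Ty]; first last.
  + by rewrite nmulZl; exact: spannedZ.
  + by rewrite nmulDl; exact: spannedD.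
  + elim: (leavitt_spanned a) => [|_ [v [p' [w' [v' [q' [pw' qw' ->]]]]]]
      |y z _ Ty _ Tz|k y _ Ty].
    * by rewrite nmulr0; exact: spanned0.
    * rewrite nmulA -[b ** _ ** _]nmulA.
      case: (gelt_pelt_cases qw pw') => [[z _ [zw' ->]]|[z _ [zw ->]]|->].
      - apply: spanned_gen; exists (b ** pelt z w'), v', q', w'; split=> //=.
        by have [v0 Yv0 v0w] := Qw; exists v0 => //; apply: tree_trans v0w _; exists z.
      - apply: spanned_gen; exists b, v', (q' ++ z), w; split=> //=.
          by apply/is_path_cat; exists w'.
        by rewrite (gelt_cat _ zw) nmulA.
      - by rewrite nmulr0 nmul0; exact: spanned0.
    * by rewrite nmulDr; exact: spannedD.
    * by rewrite nmulZr; exact: spannedZ.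
  + by rewrite nmul0; exact: spanned0.
Qed.

(** Every real path ending in [trees Y] lies in the ideal, so [x] vanishes against all the paths
    needed for [ghost_span_eq0]. *)
Lemma vertex_ideal_nondegenerate (Y : set (vertex E)) (x : L) :
  (vertex_ideal K Y : set L) x ->
  (forall y, (vertex_ideal K Y : set L) y -> x ** y = 0) -> x = 0.
Proof.
move=> /vertex_ideal_span xY x0; apply: ghost_span_eq0 xY _ => q w /= Yw.
apply: x0; rewrite -pelt_target; apply: (is_idealMl (idealP (vertex_ideal K Y))).
exact: vertex_ideal_vtx.
Qed.

(** If [v p q^* w] is nonzero, then [p] starts at [v] and [q] at [w], so their common end is in both
    trees. *)
Lemma vertex_ideal_orthogonal (Y Z : set (vertex E)) (x y : L) :
  trees Y `&` trees Z = set0 -> (vertex_ideal K Y : set L) x ->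
  (vertex_ideal K Z : set L) y -> x ** y = 0.
Proof.
move=> YZ Yx Zy.
have vaw v a w : Y v -> Z w -> vtx v ** a ** vtx w = 0.
  move=> Yv Zw; elim: (leavitt_spanned a) => [|_ [u [p [t [u' [q [pt qt ->]]]]]]
    |b c _ b0 _ c0|k b _ b0].
  - by rewrite nmulr0 nmul0.
  - rewrite nmulA -nmulA; have [vu|vu] := pselect (v = u); last first.
      by rewrite (vtx_pelt0 pt vu) nmul0.
    have [wu|wu] := pselect (w = u'); last by rewrite (gelt_vtx0 qt wu) nmulr0.
    exfalso; have : (trees Y `&` trees Z) t; last by rewrite YZ.
    by split; [exists v => //; exists p|exists w => //; exists q]; rewrite ?vu ?wu.
  - by rewrite nmulDr nmulDl b0 c0 addr0.
  - by rewrite nmulZr nmulZl b0 scaler0.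
have vy v a : Y v -> vtx v ** a ** y = 0.
  move=> Yv; move: y Zy a.
  apply: (@vertex_ideal_min Z [set y | forall a, vtx v ** a ** y = 0]); last first.
    by move=> w Zw a; exact: vaw.
  split=> [a|b c b0 c0 a|k b b0 a|b c c0 a|b c c0 a] /=.
  - by rewrite nmulr0.
  - by rewrite nmulDr b0 c0 addr0.
  - by rewrite nmulZr b0 scaler0.
  - by rewrite nmulA -[_ ** a ** b]nmulA c0.
  - by rewrite nmulA c0 nmul0.
suff [] : (forall a, x ** a ** y = 0) /\ x ** y = 0 by [].
move: x Yx.
apply: (@vertex_ideal_min Y [set x | (forall a, x ** a ** y = 0) /\ x ** y = 0]).
  split=> [|b c [b1 b0] [c1 c0]|k b [b1 b0]|a b [b1 b0]|a b [b1 b0]] /=.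
  - by split=> [a|]; rewrite !nmul0.
  - by split=> [a|]; rewrite !nmulDl ?b1 ?c1 ?b0 ?c0 addr0.
  - by split=> [a|]; rewrite !nmulZl ?b1 ?b0 scaler0.
  - by split=> [c|]; rewrite -!nmulA ?[b ** (c ** y)]nmulA ?b1 ?b0 nmulr0.
  - by split=> [c|]; rewrite // -[b ** a ** c]nmulA.
move=> v Yv; split=> [a|]; first exact: vy.
by rewrite -(vtxMM K v) vy.
Qed.

End PathElements.

(** * Matrix units over a corner *)

Section MatrixUnits.
Variables (K : pzRingType) (A R : nuAlgType K) (X : choiceType).

Local Notation unit_mx ij r := (@delta K (X * X)%type (fun=> R) ij r : fmatrix X R).

Lemma fmatrix_delta (i j k l : X) (r s : R) :
  (unit_mx (i, j) r) ** (unit_mx (k, l) s) =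
  if j == k then unit_mx (i, l) (r ** s) else 0.
Proof.
apply: dsumP => -[a b].
pose f : fmatrix X R := unit_mx (i, j) r.
pose g : fmatrix X R := unit_mx (k, l) s.
have -> : (f ** g) (a, b) = f (a, j) ** g (j, b).
  rewrite [LHS](@fmatrix_nmul_funEl K X R f g [set j])//; last first.
    move=> c d; have [[_ ->]//|ne] := pselect ((i, j) = (c, d)).
    by rewrite /f delta_diff.
  by rewrite fset_set1 big_seq_fset1.
rewrite /f /g; have [->|/eqP jk] := eqVneq j k; last first.
  by rewrite [X in _ ** X]delta_diff ?nmulr0// => -[/esym].
have [[<- <-]|ne] := pselect ((i, l) = (a, b)); first by rewrite !delta_same.
rewrite [RHS]delta_diff//; have [ia|ia] := pselect (i = a).
  by rewrite [X in _ ** X]delta_diff ?nmulr0// => -[lb]; apply: ne; rewrite ia lb.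
by rewrite delta_diff ?nmul0// => -[].
Qed.

Variables (v : A) (x y : X -> A) (phi : {linear R -> A}).
Hypothesis yx : forall i j, y i ** x j = if i == j then v else 0.
Hypothesis phil : forall r, v ** phi r = phi r.
Hypothesis phir : forall r, phi r ** v = phi r.
Hypothesis phi_inj : injective phi.
Hypothesis phiM : forall r s, phi (r ** s) = phi r ** phi s.

(** By the relation [yx], these elements multiply as matrices with the single entry [r] at the place
    [ij]. *)
Definition unit_fun (ij : X * X) (r : R) : A := x ij.1 ** phi r ** y ij.2.

Fact unit_fun_linear ij : linear (unit_fun ij).
Proof.
by move=> k r s; rewrite /unit_fun linearP nmulDr nmulDl nmulZr nmulZl.
Qed.
HB.instance Definition _ ij :=
  GRing.isLinear.Build K R A _ (unit_fun ij) (unit_fun_linear ij).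

Definition unit_lift : {linear fmatrix X R -> A} :=
  dsum_lift (fun ij => unit_fun ij : {linear R -> A}).

Lemma unit_lift_delta ij r : unit_lift (unit_mx ij r) = unit_fun ij r.
Proof. exact: dsum_lift_delta. Qed.

(** Multiplying by [y i] on the left and by [x j] on the right isolates the entry at [(i, j)]. *)
Lemma unit_lift_inj : injective unit_lift.
Proof.
suff h0 (f : fmatrix X R) : unit_lift f = 0 -> f = 0.
  move=> f g /eqP; rewrite -subr_eq0 -linearB => /eqP/h0/eqP.
  by rewrite subr_eq0 => /eqP.
move=> f0; apply: dsumP => -[i j]; apply: phi_inj; rewrite linear0.
pose k (a : A) := y i ** a ** x j.
have kadd : zmod_morphism k by move=> a b; rewrite /k nmulBr nmulBl.
pose kL : {additive A -> A} := HB.pack k (GRing.isZmodMorphism.Build A A k kadd).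
have kE a b r : k (unit_fun (a, b) r) = (y i ** x a) ** phi r ** (y b ** x j).
  by rewrite /k /unit_fun /= !nmulA.
suff <- : kL (unit_lift f) = phi (f (i, j)) by rewrite f0 raddf0.
rewrite (@dsum_lift_coord _ _ _ _ _ _ kL f (i, j)) => [|[a b] ne].
  by rewrite [LHS]kE !yx !eqxx phil phir.
rewrite [LHS]kE !yx; case: eqP => [ia|]; last by rewrite !nmul0.
case: eqP => [bj|]; last by rewrite nmulr0.
by case: ne; rewrite ia bj.
Qed.

Lemma unit_liftM f g : unit_lift (f ** g) = unit_lift f ** unit_lift g.
Proof.
elim/dsum_ind: f => [f f' IH IH'|[i j] r|].
- by rewrite [X in unit_lift X]nmulDl linearD IH IH' linearD nmulDl.
- elim/dsum_ind: g => [g g' IH IH'|[k l] s|].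
  + by rewrite [X in unit_lift X]nmulDr linearD IH IH' linearD nmulDr.
  + rewrite fmatrix_delta !unit_lift_delta /unit_fun /=.
    rewrite !nmulA -[x i ** _ ** _ ** x k]nmulA yx; case: eqP => [_|_].
      by rewrite unit_lift_delta /unit_fun /= -[_ ** v]nmulA phir phiM nmulA.
    by rewrite linear0 nmulr0 !nmul0.
  + by rewrite [X in unit_lift X]nmulr0 linear0 nmulr0.
- by rewrite [X in unit_lift X]nmul0 linear0 nmul0.
Qed.

End MatrixUnits.

(** * Vertices that reach no bifurcation *)

(** The common feature of line points and of vertices on cycles without exits, which allows one
    treatment of both. *)
Definition deterministic (E : digraph) (v : vertex E) : Prop :=
  forall w, tree v w -> ~ bifurcations w.

(** The index set of rows and columns. The end is stored because each vertex of [tree v] contributes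
    its own empty path. *)
Definition first_entries (E : digraph) (v : vertex E) :
    set (seq (edge E) * vertex E) :=
  [set t | [/\ tree v t.2, exists u, is_path u t.1 t.2 &
               forall e, e \in t.1 -> ~ tree v (source e)]].

Section DeterministicVertex.
Variables (K : fieldType) (E : digraph).
Implicit Types (u v w : vertex E) (e f : edge E) (p q z : seq (edge E)).
Local Notation L := (leavitt K E).
Local Notation vtx := (vtx K).
Local Notation edg := (edg K).
Local Notation gho := (gho K).
Local Notation pelt := (pelt K).
Local Notation gelt := (gelt K).

Lemma deterministic_tree v w : deterministic v -> tree v w -> deterministic w.
Proof. by move=> dv vw x wx; apply: dv; exact: tree_trans wx. Qed.

(** The source is regular with [e] as its only edge, so the sum in (CK2) has one term. *)
Lemma edg_gho e : ~ bifurcations (source e) -> edg e ** gho e = vtx (source e).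
Proof.
move=> nb; have emE : emitted (source e) = [set e].
  apply/seteqP; split=> [f fe|f ->] //=; apply: contrapT => ne.
  by apply: nb; exists f, e.
have reg : regular (source e) by rewrite /regular emE; split=> //; exists e.
by rewrite (CK2 K reg) emE fset_set1 big_seq_fset1.
Qed.

Lemma pelt_gelt v p w : deterministic v -> is_path v p w ->
  pelt p w ** gelt p w = vtx v.
Proof.
elim: p v => [|e p IH] v dv /=; first by move=> ->; rewrite gelt_nil vtxMM.
move=> [ev pw]; rewrite gelt_cons nmulA -[edg e ** _ ** _]nmulA (IH (target e))//.
  rewrite edg_target -ev; apply: edg_gho; apply: dv; rewrite ev; exact: tree_refl.
by apply: (deterministic_tree dv); exists [:: e].
Qed.

(** A path [p] from [w] to a vertex [u] of [tree v] gives [w = p u p^*]. Hence one vertex generates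
    the ideal of all such [w] whose paths merge with its own. *)
Lemma vertex_ideal_deterministic v w : deterministic w ->
  tree v `&` tree w !=set0 -> (vertex_ideal K [set v] : set L) (vtx w).
Proof.
move=> dw [u [vu [p wu]]]; rewrite -(pelt_gelt dw wu) -pelt_target.
have id := idealP (vertex_ideal K [set v]).
apply: (is_idealMr id); apply: (is_idealMl id); apply: vertex_ideal_vtx.
by exists v.
Qed.

Variables (v : vertex E) (R : nuAlgType K) (phi : {linear R -> L}).
Hypothesis dv : deterministic v.
Hypothesis phi_inj : injective phi.
Hypothesis phiM : forall r s, phi (r ** s) = phi r ** phi s.
Hypothesis phi_corner : range phi = [set a | vtx v ** a ** vtx v = a].

Let X : choiceType := set_type (first_entries v).

(** A fixed choice of a path from [v] to [w]; the value outside [tree v] is a dummy. *)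
Definition exit_path w : seq (edge E) :=
  if pselect (tree v w) is left vw then projT1 (cid vw) else [::].

Lemma exit_pathP w : tree v w -> is_path v (exit_path w) w.
Proof. by rewrite /exit_path; case: pselect => // vw _; case: cid. Qed.

Definition entry_exit (t : X) : seq (edge E) := exit_path (\val t).2.

Lemma entry_exitP t : is_path v (entry_exit t) (\val t).2.
Proof. by apply: exit_pathP; case: (set_valP t). Qed.

Definition entry_elt (t : X) : L :=
  pelt (\val t).1 (\val t).2 ** gelt (entry_exit t) (\val t).2.

Let y (t : X) : L := star (entry_elt t).

Lemma star_entry t : y t = pelt (entry_exit t) (\val t).2 ** gelt (\val t).1 (\val t).2.
Proof. by rewrite /y /entry_elt starM star_gelt star_pelt. Qed.

(** On the diagonal, [z p^* p z^* = z z^* = v]. Two different entries are incomparable, since a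
    proper prolongation would contain an edge starting at the end of the shorter one, in
    [tree v]. *)
Lemma entry_orth (s t : X) : y s ** entry_elt t = if s == t then vtx v else 0.
Proof.
rewrite star_entry /entry_elt nmulA -[_ ** gelt _ _ ** _]nmulA.
have := set_valP s; have := set_valP t.
have [-> _ [_ [u pw] _]|st] := eqVneq s t.
  rewrite (gelt_pelt K pw) pelt_target.
  by apply: pelt_gelt => //; exact: entry_exitP.
have {st} : (\val s == \val t) = false by apply/negbTE.
move: (entry_exit s) (entry_exit t).
case: (\val s) (\val t) => [p w] [q w'] z z' ne.
move=> [/= vw' [u' /= qw'] /= qn] [/= vw [u /= pw] /= pn].
have path0 a b r x y0 : tree v a -> (forall e, e \in b -> ~ tree v (source e)) ->
    b = r ++ x -> is_path a x y0 -> x = [::].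
  move=> va bn bE; case: x bE => //= e x bE [ea _].
  by case: (bn e); rewrite ?bE ?mem_cat ?inE ?eqxx ?orbT// ea.
case: (gelt_pelt_cases K pw qw') => [[x xE [xw _]]|[x xE [xw _]]|->].
- have x0 := path0 _ _ _ _ _ vw qn xE xw; move: ne xw.
  by rewrite xE x0 cats0 => ne /= ww'; move: ne; rewrite ww' eqxx.
- have x0 := path0 _ _ _ _ _ vw' pn xE xw; move: ne xw.
  by rewrite xE x0 cats0 => ne /= ww'; move: ne; rewrite ww' eqxx.
- by rewrite nmulr0 nmul0.
Qed.

Lemma phil r : vtx v ** phi r = phi r.
Proof.
have : range phi (phi r) by exists r.
by rewrite phi_corner /= => <-; rewrite !nmulA vtxMM.
Qed.

Lemma phir r : phi r ** vtx v = phi r.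
Proof.
have : range phi (phi r) by exists r.
by rewrite phi_corner /= => <-; rewrite -!nmulA vtxMM.
Qed.

Let lift : {linear fmatrix X R -> L} := unit_lift entry_elt y phi.

Lemma lift_unit (s t : X) a : vtx v ** a ** vtx v = a ->
  range lift (entry_elt s ** a ** y t).
Proof.
move=> va; have : [set a | vtx v ** a ** vtx v = a] a by [].
rewrite -phi_corner => -[r _ <-].
by exists (@delta K (X * X)%type (fun=> R) (s, t) r) => //; rewrite unit_lift_delta.
Qed.

Lemma entry_mem w : tree v w -> ([::], w) \in first_entries v.
Proof. by move=> vw; rewrite inE; split=> //; exists w. Qed.

(** For the empty entry at [w] and its chosen path [z] from [v], [a = z^* (z a)], and [z a] lies in
    the corner at [v]. *)
Lemma lift_tree (t : X) w a : tree v w -> vtx w ** a = a -> a ** vtx v = a ->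
  range lift (a ** y t).
Proof.
move=> vw wa av; pose s : X := SigSub (entry_mem vw).
have sE : entry_elt s = gelt (entry_exit s) w by rewrite /entry_elt /= target_gelt.
have -> : a = entry_elt s ** (y s ** a).
  rewrite nmulA /y sE star_gelt (gelt_pelt K (entry_exitP s)).
  by rewrite wa.
apply: lift_unit; rewrite -!nmulA av /y sE star_gelt nmulA.
by rewrite (source_pelt K (entry_exitP s)).
Qed.

(** It suffices to multiply units by generators. If the source of the edge is in [tree v],
    [lift_tree] applies; otherwise an edge prolongs the entry to a new one and a ghost edge strips
    its first edge, unless the product is zero. *)
Lemma lift_mull a b : range lift b -> range lift (a ** b).
Proof.
have rD c d : range lift c -> range lift d -> range lift (c + d).
  by move=> [f _ <-] [g _ <-]; exists (f + g) => //; rewrite linearD.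
have r0 : range lift 0 by exists 0 => //; rewrite linear0.
have rZ k c : range lift c -> range lift (k *: c).
  by move=> [f _ <-]; exists (k *: f) => //; rewrite linearZ.
suff gen c : (forall s t r, range lift (c ** (entry_elt s ** phi r ** y t))) ->
    forall b, range lift b -> range lift (c ** b).
  elim/leavitt_ind: a b => [|w|e|e|c d IHc IHd|k c IHc|c d IHc IHd] b rb.
  - by rewrite nmul0.
  - apply: gen b rb => s t r; have [_ [u pw] _] := set_valP s; rewrite nmul3A.
    have [->|/eqP wu] := eqVneq w u; last first.
      by rewrite /entry_elt nmulA (vtx_pelt0 K pw wu) !nmul0.
    rewrite {1}/entry_elt nmulA (source_pelt K pw).
    by apply: lift_unit; rewrite phil phir.
  - apply: gen b rb => s t r; have [vw [u pw] pn] := set_valP s.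
    rewrite nmul3A; have [ve|ve] := pselect (tree v (source e)).
      apply: (lift_tree _ ve); last by rewrite -nmulA phir.
      by rewrite nmulA [vtx _ ** _]nmulA source_edg.
    have [eu|/eqP eu] := eqVneq (target e) u; last first.
      rewrite /entry_elt -(edg_target K e) nmulA -[edg e ** _ ** _]nmulA.
      by rewrite (vtx_pelt0 K pw eu) nmulr0 !nmul0.
    have sX : (e :: (\val s).1, (\val s).2) \in first_entries v.
      rewrite inE; split=> //=; first by exists (source e); rewrite eu.
      by move=> f; rewrite inE => /orP[/eqP ->//|/pn].
    have -> : edg e ** entry_elt s = entry_elt (SigSub sX : X).
      by rewrite /entry_elt nmulA.
    by apply: lift_unit; rewrite phil phir.
  - apply: gen b rb => s t r; have [vw [u pw] pn] := set_valP s.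
    rewrite nmul3A; have [ve|ve] := pselect (tree v (source e)).
      apply: (lift_tree _ (tree_target ve)); last by rewrite -nmulA phir.
      by rewrite nmulA [vtx _ ** _]nmulA target_gho.
    have [eu|/eqP eu] := eqVneq (source e) u; last first.
      rewrite /entry_elt -(gho_source K e) nmulA -[gho e ** _ ** _]nmulA.
      by rewrite (vtx_pelt0 K pw eu) nmulr0 !nmul0.
    (* The entry is not empty, since it starts at [source e], which is outside [tree v]. *)
    case pE : (\val s).1 pw pn => [|f p] pw pn.
      by case: ve; rewrite eu [u]pw.
    have [_ pw'] := pw.
    have sE : entry_elt s = edg f ** (pelt p (\val s).2 ** gelt (entry_exit s) (\val s).2).
      by rewrite /entry_elt pE nmulA.
    rewrite sE nmulA gho_edg; case: eqP => [->|_]; last by rewrite !nmul0.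
    have sX : (p, (\val s).2) \in first_entries v.
      rewrite inE; split=> //=; first by exists (target f).
      by move=> g gp; apply: pn; rewrite inE gp orbT.
    rewrite nmulA (source_pelt K pw').
    rewrite -[pelt p _ ** _]/(entry_elt (SigSub sX)).
    by apply: lift_unit; rewrite phil phir.
  - by rewrite nmulDl; apply: rD; [exact: IHc|exact: IHd].
  - by rewrite nmulZl; apply: rZ; exact: IHc.
  - by rewrite -nmulA; apply: IHc; exact: IHd.
move=> cg _ [f _ <-]; elim/dsum_ind: f => [f g IHf IHg|[s t] r|].
- by rewrite linearD nmulDr; exact: rD.
- by rewrite unit_lift_delta; exact: cg.
- by rewrite linear0 nmulr0.
Qed.

(** The involution transposes the units and preserves the corner; this reduces right multiplication
    to left multiplication. *)
Lemma lift_star b : range lift b -> range lift (star b).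
Proof.
move=> [f _ <-]; elim/dsum_ind: f => [f g [f' _ IHf] [g' _ IHg]|[s t] r|].
- by exists (f' + g') => //; rewrite !linearD IHf IHg.
- rewrite unit_lift_delta.
  have -> : star (unit_fun entry_elt y phi (s, t) r) = entry_elt t ** star (phi r) ** y s.
    by rewrite /unit_fun /= starM [star (_ ** phi r)]starM [star (y t)]starK nmulA.
  by apply: lift_unit; rewrite -[in LHS](star_vtx K v) -!starM nmulA phil phir.
- by exists 0 => //; rewrite !linear0.
Qed.

Lemma embeds_deterministic :
  embeds (fmatrix X R) (vertex_ideal K [set v] : set L).
Proof.
exists lift; split.
- exact: unit_lift_inj entry_orth phil phir phi_inj.
- exact: unit_liftM entry_orth phir phiM.
apply/seteqP; split=> [_ [f _ <-]|].
  have id := idealP (vertex_ideal K [set v]).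
  elim/dsum_ind: f => [f g IHf IHg|[s t] r|].
  - by rewrite linearD; exact: (is_idealD id).
  - rewrite unit_lift_delta /unit_fun -phil; apply: (is_idealMr id).
    apply: (is_idealMl id); apply: (is_idealMr id); apply: vertex_ideal_vtx.
    by exists v => //; exact: tree_refl.
  - by rewrite linear0; exact: (is_ideal0 id).
apply: (@vertex_ideal_min K E [set v] (range lift)).
  split.
  - by exists 0 => //; rewrite linear0.
  - by move=> _ _ [f _ <-] [g _ <-]; exists (f + g) => //; rewrite linearD.
  - by move=> k _ [f _ <-]; exists (k *: f) => //; rewrite linearZ.
  - by move=> a b; exact: lift_mull.
  - move=> a b /lift_star lb; rewrite -[b ** a]starK starM.
    exact/lift_star/lift_mull.
move=> _ ->.
(* The empty entry at [v] gives [v = z^* v z], where the chosen path [z] from [v] to itself need not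
   be empty. *)
pose t : X := SigSub (entry_mem (tree_refl v)).
have -> : vtx v = entry_elt t ** vtx v ** y t.
  rewrite star_entry /entry_elt /= target_gelt (gelt_source K (entry_exitP t)).
  by rewrite gelt_nil pelt_target -[LHS](gelt_pelt K (entry_exitP t)).
by apply: lift_unit; rewrite !vtxMM.
Qed.

End DeterministicVertex.

(** * Cycles, and paths without choices *)

Section Cycles.
Variable E : digraph.
Implicit Types (u v w : vertex E) (e f : edge E) (p q z c d : seq (edge E)).

Lemma cycle_vertices_hd v c : is_path v c v -> c <> [::] -> cycle_vertices c v.
Proof. by case: c => // e c /= [<- _] _; exists e => //; rewrite inE eqxx. Qed.

Lemma not_uniq_source p : ~~ uniq (map source p) ->
  exists p1 e p2 f p3, p = p1 ++ e :: p2 ++ f :: p3 /\ source e = source f.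
Proof.
elim: p => //= e p IH; rewrite negb_and negbK => /orP[/mapP[f fp ef]|/IH].
  case/splitPr: fp => p2 p3; by exists [::], e, p2, f, p3.
by move=> [p1 [e' [p2 [f [p3 [-> ef]]]]]]; exists (e :: p1), e', p2, f, p3.
Qed.

(** When a source is repeated, cutting out the detour between the two occurrences leaves a shorter
    nonempty closed path at [u]. *)
Lemma closed_path_cycle u p : is_path u p u -> p <> [::] ->
  exists2 c, cycles c & cycle_vertices c u.
Proof.
have [n] := ubnP (size p); elim: n p => // n IH p; rewrite ltnS => pn pu p0.
have [up|/not_uniq_source[p1 [e [p2 [f [p3 [pE ef]]]]]]] := boolP (uniq (map source p)).
  by exists p; [split=> //; exists u|exact: cycle_vertices_hd].
apply: (IH (p1 ++ f :: p3)).
- by apply: leq_trans pn; rewrite pE !size_cat /= size_cat /=; lia.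
- move: pu; rewrite pE => /is_path_cat[x px /= [ex /is_path_cat[y _ /= [_ fu]]]].
  by apply/is_path_cat; exists x => //=; rewrite -ef.
- by case: (p1).
Qed.

Lemma cycle_target c e : cycles c -> e \in c -> cycle_vertices c (target e).
Proof.
move=> [c0 [v cv] _] ec; move: ec cv => /[dup] ec /splitPr[c1 c2] cv; move: (cv).
move=> /is_path_cat[x _ /= [_ c2v]]; case: c2 c2v cv {ec} => [|f c2] /= c2v cv.
  by rewrite c2v; apply: cycle_vertices_hd => //; case: c1 {cv}.
by case: c2v => fe _; exists f => //; rewrite mem_cat !inE eqxx !orbT.
Qed.

Lemma cycle_connected c u w : cycles c -> cycle_vertices c u ->
  cycle_vertices c w -> tree u w.
Proof.
move=> [_ [v cv] _].
have to x : cycle_vertices c x -> tree x v.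
  move=> [e /[swap] <-{x} ec]; case/splitPr: ec cv => c1 c2 /is_path_cat[x _ ec2].
  by exists (e :: c2); split=> //; case: ec2.
have from x : cycle_vertices c x -> tree v x.
  move=> [e /[swap] <-{x} ec]; case/splitPr: ec cv => c1 c2 /is_path_cat[x c1x [ex _]].
  by exists c1; rewrite ex.
by move=> /to uv /from; exact: tree_trans.
Qed.

Lemma noexit_edge c e f : noexit_cycles E c -> f \in c -> source e = source f -> e \in c.
Proof.
move=> [_ cex] fc ef; have [->//|/eqP ne] := eqVneq e f.
by have : exits c e by [exists f]; rewrite cex.
Qed.

Lemma noexit_tree c u w : noexit_cycles E c -> cycle_vertices c u -> tree u w ->
  cycle_vertices c w.
Proof.
move=> nc + [p]; elim: p u => [|e p IH] u /=; first by move=> ? <-.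
move=> [f fc fu] [eu pw]; apply: IH pw; apply: cycle_target; first by case: nc.
by apply: noexit_edge fc _ => //; rewrite fu.
Qed.

Lemma noexit_deterministic c v : noexit_cycles E c -> cycle_vertices c v ->
  deterministic v.
Proof.
move=> nc cv w vw [e [f [ew fw ne]]].
have [g gc gw] := noexit_tree nc cv vw.
have ec : e \in c by apply: noexit_edge gc _ => //; rewrite gw.
have : exits c f by exists e => //; split; [rewrite ew|move/esym].
by case: nc => _ ->.
Qed.

Lemma line_deterministic v : P_l E v -> deterministic v.
Proof. by move=> lv w /lv[]. Qed.

Lemma deterministic_prefix v p w q w' : deterministic v -> is_path v p w ->
  is_path v q w' -> (exists z, q = p ++ z) \/ (exists z, p = q ++ z).
Proof.
elim: p v q => [|e p IH] v [|f q] dv; try by [left; exists [::]|left; exists (f :: q)].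
  by right; exists (e :: p).
move=> [ev pw] [fv qw'].
have ef : e = f.
  apply: contrapT => ne; apply: (dv v); first exact: tree_refl.
  by exists e, f.
rewrite -{}ef in fv qw' *.
have dt : deterministic (target e) by apply: (deterministic_tree dv); exists [:: e].
by case: (IH _ _ dt pw qw') => -[z ->]; [left|right]; exists z.
Qed.

(** One path prolongs the other, and a nonempty remainder would be a closed path at [w], hence give
    a cycle in [tree v]. *)
Lemma line_path_unique v p q w : P_l E v -> is_path v p w -> is_path v q w -> p = q.
Proof.
move=> lv; wlog [z ->] : p q / exists z, q = p ++ z.
  move=> wl pw qw; have [pq|qp] := deterministic_prefix (line_deterministic lv) pw qw.
    exact: wl.
  by apply/esym/wl.
move=> pw /is_path_cat[x px xw]; rewrite -(is_path_end pw px) in xw.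
case: z xw => [|e z] zw; first by rewrite cats0.
have [_ []] := lv w (ex_intro _ p pw).
by apply: closed_path_cycle zw _.
Qed.

(** The paths [p] and [c] are comparable. Either [c] splits off from [p] and induction applies, or
    [p] is a prefix of [c]; a proper nonempty one would return to [v] too early, repeating a source
    within [c]. *)
Lemma cycle_power c v p : noexit_cycles E c -> is_path v c v -> is_path v p v ->
  exists m, p = flatten (nseq m c).
Proof.
move=> nc cv; have [n] := ubnP (size p); elim: n p => // n IH p; rewrite ltnS => pn pv.
have [c0 _ uc] := nc.1.
have dv := noexit_deterministic nc (cycle_vertices_hd cv c0).
have [[z cE]|[z pE]] := deterministic_prefix dv pv cv.
  case: p cE pv {pn} => [|e p] cE pv; first by exists 0%N.
  case: z cE => [|f z] cE; first by exists 1%N; rewrite /= cats0 cE cats0.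
  move: cv uc; rewrite cE => /(is_path_cat v (e :: p))[x px [fx _]].
  have := is_path_end px pv; case: pv => ev _ xv.
  rewrite map_cat cat_uniq /= => /and3P[_]; rewrite negb_or.
  by rewrite inE fx xv ev eqxx.
have [x cx zv] : exists2 x, is_path v c x & is_path x z v.
  by apply/is_path_cat; rewrite -pE.
have {cx} xv := is_path_end cx cv; rewrite xv in zv.
have [m zE] : exists m, z = flatten (nseq m c).
  apply: IH zv; apply: leq_trans pn; rewrite pE size_cat.
  by case: (c) c0 => //= *; lia.
by exists m.+1; rewrite pE zE.
Qed.

End Cycles.

(** * The corners at line points and at cycles without exits *)

Section Corners.
Variables (K : fieldType) (E : digraph).
Implicit Types (u v w : vertex E) (e f : edge E) (p q z c : seq (edge E)).
Local Notation L := (leavitt K E).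
Local Notation vtx := (vtx K).
Local Notation pelt := (pelt K).
Local Notation gelt := (gelt K).

Lemma corner_spanned v (S : set L) :
  (forall p q w, is_path v p w -> is_path v q w -> spanned S (pelt p w ** gelt q w)) ->
  forall a, spanned S (vtx v ** a ** vtx v).
Proof.
move=> Spq a; elim: (leavitt_spanned a) => [|_ [u [p [w [u' [q [pw qw ->]]]]]]
  |b c _ Sb _ Sc|k b _ Sb].
- by rewrite nmulr0 nmul0; exact: spanned0.
- rewrite nmulA -nmulA; have [vu|vu] := pselect (v = u); last first.
    by rewrite (vtx_pelt0 K pw vu) nmul0; exact: spanned0.
  have [vu'|vu'] := pselect (v = u'); last first.
    by rewrite (gelt_vtx0 K qw vu') nmulr0; exact: spanned0.
  rewrite -vu in pw; rewrite -vu' in qw.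
  by rewrite (source_pelt K pw) (gelt_source K qw); exact: Spq.
- by rewrite nmulDr nmulDl; exact: spannedD.
- by rewrite nmulZr nmulZl; exact: spannedZ.
Qed.

Lemma vtx_neq0 v : vtx v <> 0.
Proof.
move=> v0; have vv : is_path v [::] v by [].
have := coef_pelt K vv vv; rewrite [X in coef _ _ X](v0 : pelt [::] v = 0).
rewrite linear0 eqxx => /esym/eqP.
by rewrite oner_eq0.
Qed.

(** A monomial [p q^*] of the corner has [p = q] by [line_path_unique], and [p p^* = v], so the
    corner is [K v]. *)
Lemma embeds_line v : P_l E v ->
  embeds (fmatrix (set_type (first_entries v)) K^o) (vertex_ideal K [set v] : set L).
Proof.
move=> lv; have dv := line_deterministic lv.
pose phi (k : K^o) : L := (k : K) *: vtx v.
have phi_lin : linear phi by move=> k x y; rewrite /phi scalerDl scalerA.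
pose phiL : {linear K^o -> L} := HB.pack phi
  (GRing.isLinear.Build K K^o L _ phi phi_lin).
apply: (embeds_deterministic (phi := phiL) dv).
- move=> k l /= /eqP; rewrite -subr_eq0 -scalerBl scaler_eq0 => /orP[|/eqP/vtx_neq0//].
  by rewrite subr_eq0 => /eqP.
- by move=> k l; rewrite /= /phi nmulZl nmulZr vtxMM scalerA.
apply/seteqP; split=> [_ [k _ <-]|a /= <-].
  by rewrite /= /phi nmulZr nmulZl !vtxMM.
have : spanned [set vtx v] (vtx v ** a ** vtx v).
  apply: corner_spanned => p q w pw qw; apply: spanned_gen.
  by rewrite /= -(line_path_unique lv pw qw) (pelt_gelt K dv pw).
elim=> [|_ ->|b c _ [k _ <-] _ [l _ <-]|k b _ [l _ <-]].
- by exists 0 => //; rewrite /= /phi scale0r.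
- by exists 1 => //; rewrite /= /phi scale1r.
- by exists (k + l) => //; rewrite /= /phi scalerDl.
- by exists (k * l) => //; rewrite /= /phi scalerA.
Qed.

Lemma laurent_delta (m n : int) (k l : K) :
  (@delta K int (fun=> K^o) m k : laurent K) ** (@delta K int (fun=> K^o) n l : laurent K) =
  @delta K int (fun=> K^o) (m + n) (k * l).
Proof.
apply: dsumP => a.
rewrite [LHS](@laurent_nmul_funE K _ _ [set m])//; last first.
  by move=> i; have [->//|mi] := pselect (m = i); rewrite delta_diff.
rewrite fset_set1 big_seq_fset1 delta_same.
have [<-|mna] := pselect (m + n = a).
  by rewrite (_ : m + n - m = n) ?delta_same// addrAC subrr add0r.
rewrite !delta_diff ?mulr0// => na; apply: mna; lia.
Qed.

Section CyclePowers.
Variables (c : seq (edge E)) (v : vertex E).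
Hypothesis nc : noexit_cycles E c.
Hypothesis cv : is_path v c v.

Let cpow m := flatten (nseq m c).

Let cpowD m n : cpow (m + n) = cpow m ++ cpow n.
Proof. by rewrite /cpow nseqD flatten_cat. Qed.

Let cpow_path m : is_path v (cpow m) v.
Proof.
elim: m => //= m IH; apply/(is_path_cat v c); by exists v.
Qed.

Let size_cpow m : size (cpow m) = (m * size c)%N.
Proof. by elim: m => //= m; rewrite size_cat mulSn => ->. Qed.

Let dv : deterministic v.
Proof.
by apply: (noexit_deterministic nc); apply: cycle_vertices_hd => //; case: nc => -[].
Qed.

(** The powers of the cycle, negative ones being powers of its ghost; [Negz m] stands for
    [-(m+1)]. *)
Definition cycle_elt (n : int) : L :=
  match n with Posz m => pelt (cpow m) v | Negz m => gelt (cpow m.+1) v end.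

Lemma cycle_eltE m n : cycle_elt (m%:Z - n%:Z) = pelt (cpow m) v ** gelt (cpow n) v.
Proof.
have [nm|mn] := leqP n m.
  have [d ->] : exists d, m = (d + n)%N by exists (m - n)%N; lia.
  have -> : (d + n)%N%:Z - n%:Z = d by lia.
  rewrite cpowD (pelt_cat _ _ (cpow_path n)) -nmulA (pelt_gelt K dv (cpow_path n)).
  by rewrite pelt_target.
have [d ->] : exists d, n = (d.+1 + m)%N by exists (n - m).-1; lia.
have -> : m%:Z - (d.+1 + m)%N%:Z = Negz d by lia.
rewrite cpowD (gelt_cat _ _ (cpow_path m)) nmulA (pelt_gelt K dv (cpow_path m)).
by rewrite target_gelt.
Qed.

Lemma cycle_eltM k l : cycle_elt k ** cycle_elt l = cycle_elt (k + l).
Proof.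
(* This [n] is large enough to write [k = m - n] and [l = n - n'] with natural [m] and [n']; the
   inner powers of exponent [n] then cancel. *)
pose n := (absz k + absz l)%N.
have [m mE] : exists m : nat, k = m%:Z - n%:Z by exists (absz (k + n%:Z)); lia.
have [n' nE] : exists n' : nat, l = n%:Z - n'%:Z by exists (absz (n%:Z - l)); lia.
have -> : k + l = m%:Z - n'%:Z by lia.
rewrite mE nE !cycle_eltE nmulA -[pelt _ v ** _ ** _]nmulA.
by rewrite (gelt_pelt K (cpow_path n)) pelt_target.
Qed.

Lemma cycle_elt0 : cycle_elt 0 = vtx v. Proof. by []. Qed.

Let gam (n : int) (k : K^o) : L := (k : K) *: cycle_elt n.
Fact gam_linear n : linear (gam n).
Proof. by move=> k x y; rewrite /gam scalerDl scalerA. Qed.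
HB.instance Definition _ n := GRing.isLinear.Build K K^o L _ (gam n) (gam_linear n).

Definition laurent_lift : {linear laurent K -> L} :=
  dsum_lift (fun n => gam n : {linear K^o -> L}).

Lemma laurent_lift_delta n (k : K) :
  laurent_lift (@delta K int (fun=> K^o) n k) = k *: cycle_elt n.
Proof. exact: dsum_lift_delta. Qed.

Lemma laurent_liftM (f g : laurent K) : laurent_lift (f ** g) = laurent_lift f ** laurent_lift g.
Proof.
elim/dsum_ind: f => [f f' IH IH'|m k|].
- by rewrite [X in laurent_lift X]nmulDl linearD IH IH' linearD nmulDl.
- elim/dsum_ind: g => [g g' IH IH'|n l|].
  + by rewrite [X in laurent_lift X]nmulDr linearD IH IH' linearD nmulDr.
  + rewrite laurent_delta !laurent_lift_delta nmulZl nmulZr cycle_eltM.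
    by rewrite scalerA.
  + by rewrite [X in laurent_lift X]nmulr0 linear0 nmulr0.
- by rewrite [X in laurent_lift X]nmul0 linear0 nmul0.
Qed.

(* Multiplication by a high power of the cycle turns the sum into a combination
   of real paths, which are linearly independent. *)
Lemma laurent_lift_inj : injective laurent_lift.
Proof.
suff h0 (f : laurent K) : laurent_lift f = 0 -> f = 0.
  move=> f g /eqP; rewrite -subr_eq0 -linearB => /eqP/h0/eqP.
  by rewrite subr_eq0 => /eqP.
move=> f0; apply: dsumP => n; apply/eqP/negPn/negP => fn0.
have [N fN] : exists N : nat, forall j, f j != 0 -> (absz j <= N)%N.
  have /finite_seqP[s fs] := dsum_finite f.
  exists (\max_(j <- s) absz j)%N => j fj; apply: (@leq_bigmax_seq _ s xpredT absz) => //.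
  by have : [set i | f i != 0] j by []; rewrite fs.
pose kap (a : L) : K^o := coef (cpow (absz (n + N%:Z))) v (pelt (cpow N) v ** a).
have kap_add : zmod_morphism kap by move=> a b; rewrite /kap nmulBr linearB.
pose kapL : {additive L -> K^o} := HB.pack kap
  (GRing.isZmodMorphism.Build L K^o kap kap_add).
have kapE j : f j != 0 -> kap (gam j (f j)) = f j * (n == j)%:R.
  move=> fj; rewrite /kap /gam nmulZr linearZ /=; congr (_ * _).
  have -> : pelt (cpow N) v ** cycle_elt j = pelt (cpow (absz (j + N%:Z))) v.
    have := fN _ fj; rewrite -[pelt (cpow N) v]/(cycle_elt N) cycle_eltM => jN.
    by have -> : N%:Z + j = (absz (j + N%:Z)) by lia.
  rewrite (coef_pelt K (cpow_path _) (cpow_path _)).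
  have -> // : (cpow (absz (n + N%:Z)) == cpow (absz (j + N%:Z))) = (n == j).
  apply/eqP/eqP => [/(congr1 size)|->//]; rewrite !size_cpow.
  have c0 : (0 < size c)%N by case: nc => -[]; case: (c).
  move/eqP; rewrite eqn_pmul2r// => /eqP; have := fN _ fj; have := fN _ fn0; lia.
have : kapL (laurent_lift f) = kapL (gam n (f n)).
  apply: dsum_lift_coord => j jn; have [->|fj] := eqVneq (f j) 0.
    by rewrite linear0 raddf0.
  rewrite [LHS](kapE j fj); case: eqP => [nj|]; last by rewrite mulr0.
  by rewrite nj in jn.
rewrite f0 raddf0 [RHS](kapE n fn0) eqxx mulr1 => /esym/eqP.
by rewrite (negbTE fn0).
Qed.

Lemma embeds_cycle :
  embeds (fmatrix (set_type (first_entries v)) (laurent K)) (vertex_ideal K [set v] : set L).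
Proof.
apply: (embeds_deterministic (phi := laurent_lift) dv).
- exact: laurent_lift_inj.
- exact: laurent_liftM.
apply/seteqP; split=> [_ [f _ <-]|a /= <-].
  elim/dsum_ind: f => [f g IHf IHg|n k|].
  - by rewrite linearD /= nmulDr nmulDl IHf IHg.
  - rewrite laurent_lift_delta /= nmulZr nmulZl; congr (_ *: _).
    by rewrite -cycle_elt0 !cycle_eltM add0r addr0.
  - by rewrite linear0 /= nmulr0 nmul0.
have : spanned [set cycle_elt n | n in [set: int]] (vtx v ** a ** vtx v).
  apply: corner_spanned => p q w pw qw.
  have c0 : cycle_vertices c v by apply: cycle_vertices_hd => //; case: nc => -[].
  have vw : tree v w by exists p.
  (* Appending a path [t] back to [v] makes both paths closed, hence powers of the cycle; it does
     not change the monomial because [t t^* = w]. *)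
  have [t tv] := cycle_connected nc.1 (noexit_tree nc c0 vw) c0.
  have dw := deterministic_tree dv vw.
  rewrite -(pelt_target K p w) -(pelt_gelt K dw tv) nmulA -nmulA.
  rewrite -(pelt_cat _ _ tv) -(gelt_cat _ _ tv).
  have cl r : is_path v r w -> is_path v (r ++ t) v.
    by move=> rw; apply/is_path_cat; exists w.
  have [m ->] := cycle_power nc cv (cl p pw).
  have [n ->] := cycle_power nc cv (cl q qw).
  by apply: spanned_gen; exists (m%:Z - n%:Z) => //; rewrite cycle_eltE.
elim=> [|_ [n _ <-]|b b' _ [k _ <-] _ [l _ <-]|k b _ [l _ <-]].
- by exists 0 => //; rewrite linear0.
- by exists (@delta K int (fun=> K^o) n 1) => //; rewrite laurent_lift_delta scale1r.
- by exists (k + l) => //; rewrite linearD.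
- by exists (k *: l) => //; rewrite linearZ.
Qed.

End CyclePowers.
End Corners.

(** * Density *)

Section Reduction.
Variables (K : fieldType) (E : digraph).
Implicit Types (u v w : vertex E) (e f : edge E) (p q z c : seq (edge E)).
Local Notation L := (leavitt K E).
Local Notation vtx := (vtx K).
Local Notation edg := (edg K).
Local Notation gho := (gho K).
Local Notation pelt := (pelt K).
Local Notation gelt := (gelt K).

Definition real_paths w : set L := [set x | exists2 p, exists u, is_path u p w & x = pelt p w].

(** Different paths [p] have different prolongations [p q], and these are linearly independent. *)
Lemma real_path_cancel w q w' (a : L) : spanned (real_paths w) a ->
  is_path w q w' -> a ** pelt q w' = 0 -> a = 0.
Proof.
move=> sa qw' aq.
pose X : choiceType := set_type [set p | exists u, is_path u p w].
pose F (t : X) (k : K^o) : L := (k : K) *: pelt (\val t) w.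
have F_lin t : linear (F t) by move=> k x y; rewrite /F scalerDl scalerA.
pose FL t : {linear K^o -> L} := HB.pack (F t) (GRing.isLinear.Build K K^o L _ (F t) (F_lin t)).
have [f fa] : exists f : dsum (fun _ : X => K^o), dsum_lift FL f = a.
  elim: sa {aq} => [|_ [p [u pw] ->]|b c _ [f <-] _ [g <-]|k b _ [f <-]].
  - by exists 0; rewrite linear0.
  - have pX : p \in [set p | exists u, is_path u p w] by rewrite inE; exists u.
    exists (@delta K X (fun=> K^o) (SigSub pX) 1).
    by rewrite dsum_lift_delta /= /F scale1r.
  - by exists (f + g); rewrite linearD.
  - by exists (k *: f); rewrite linearZ.
suff -> : a = 0 by [].
rewrite -fa (_ : f = 0) ?linear0//; apply: dsumP => t.
pose kap (b : L) : K^o := coef (\val t ++ q) w' (b ** pelt q w').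
have kap_add : zmod_morphism kap by move=> b c; rewrite /kap nmulBl linearB.
pose kapL : {additive L -> K^o} := HB.pack kap
  (GRing.isZmodMorphism.Build L K^o kap kap_add).
have valid (s : X) : exists u, is_path u (\val s ++ q) w'.
  have [u sw] : exists u, is_path u (\val s) w := set_valP s.
  by exists u; apply/is_path_cat; exists w.
have kapE s (k : K) : kap (F s k) = k * (t == s)%:R.
  rewrite /kap /F nmulZl linearZ /= -(pelt_cat _ _ qw'); congr (_ * _).
  have [u tw] := valid t; have [u' sw] := valid s.
  rewrite (coef_pelt K tw sw); have -> // : (\val t ++ q == \val s ++ q) = (t == s).
  apply/eqP/eqP => [/(congr1 rev)/eqP|->//].
  by rewrite !rev_cat eqseq_cat// eqxx => /eqP/(can_inj revK)/val_inj.
have : kapL (dsum_lift FL f) = kapL (FL t (f t)).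
  apply: dsum_lift_coord => s st; rewrite [LHS]kapE.
  by case: eqP => [/esym//|_]; rewrite mulr0.
have -> : kapL (dsum_lift FL f) = 0 by rewrite fa /= /kap aq linear0.
by rewrite [RHS]kapE eqxx mulr1 => /esym.
Qed.

(** The bound on the length of the ghost part is the induction measure of the reduction. *)
Definition bounded_monomials n v : set L :=
  [set x | exists p w q, [/\ exists u, is_path u p w, is_path v q w,
     (size q <= n)%N & x = pelt p w ** gelt q w]].

Lemma real_paths_vtx v x : spanned (real_paths v) x -> x ** vtx v = x.
Proof.
elim=> [|_ [p _ ->]|y z _ yv _ zv|k y _ yv].
- by rewrite nmul0.
- exact: pelt_target.
- by rewrite nmulDl yv zv.
- by rewrite nmulZl yv.
Qed.

Lemma bounded_edg n v x e : spanned (bounded_monomials n.+1 v) x -> source e = v ->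
  spanned (bounded_monomials n (target e)) (x ** edg e).
Proof.
move=> sx ev; elim: sx => [|_ [p [w [q [[u pw] qw qn ->]]]]|y z _ sy _ sz|k y _ sy].
- by rewrite nmul0; exact: spanned0.
- case: q qw qn => [|f q] qw qn.
    rewrite gelt_nil pelt_target -[in pelt _ _]qw -ev.
    have ee : is_path (source e) [:: e] (target e) by [].
    have -> : edg e = pelt [:: e] (target e) by rewrite /= edg_target.
    rewrite -(pelt_cat _ _ ee); apply: spanned_gen.
    exists (p ++ [:: e]), (target e), [::]; split=> //.
      by exists u; apply/is_path_cat; exists (source e) => //; rewrite ev qw.
    by rewrite gelt_nil pelt_target.
  have [fv qw'] := qw; rewrite gelt_cons -nmulA -nmulA gho_edg.
  case: eqP => [fe|_]; last by rewrite !nmulr0; exact: spanned0.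
  rewrite (gelt_source K qw'); apply: spanned_gen; exists p, w, q.
  by split=> //; [exists u|rewrite -fe].
- by rewrite nmulDl; exact: spannedD.
- by rewrite nmulZl; exact: spannedZ.
Qed.

(** The real part [a] collects the monomials with empty ghost part. Any other monomial is a left
    multiple of the ghost of the first edge of its [q], and [s] lists these finitely many edges. *)
Lemma bounded_split n v x : spanned (bounded_monomials n v) x ->
  exists a y (s : seq (edge E)), [/\ x = a + y, spanned (real_paths v) a,
    forall e, e \in s -> source e = v &
    spanned (ghost_multiples [set t | exists2 e, e \in s & t = ([:: e], target e)]) y].
Proof.
elim=> [|_ [p [w [q [[u pw] qw qn ->]]]]
  |_ _ _ [a [y [s [-> sa sv sy]]]] _ [b [z [t [-> sb tv sz]]]]
  |k _ _ [a [y [s [-> sa sv sy]]]]].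
- by exists 0, 0, [::]; split=> //; [rewrite addr0|exact: spanned0|exact: spanned0].
- case: q qw qn => [|f q] qw qn.
    exists (pelt p w), 0, [::]; split=> //; last exact: spanned0.
      by rewrite addr0 gelt_nil pelt_target.
    by rewrite [v]qw; apply: spanned_gen; exists p => //; exists u.
  have [fv qw'] := qw.
  exists 0, (pelt p w ** gelt (f :: q) w), [:: f]; split.
  + by rewrite add0r.
  + exact: spanned0.
  + by move=> e; rewrite inE => /eqP ->.
  apply: spanned_gen; exists (pelt p w ** gelt q w), (source f), [:: f], (target f).
  split=> //; first by exists f => //; rewrite inE.
  by rewrite !gelt_cons gelt_nil target_gho nmulA.
- exists (a + b), (y + z), (s ++ t); split.
  + by rewrite addrACA.
  + exact: spannedD.
  + by move=> e; rewrite mem_cat => /orP[/sv|/tv].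
  apply: spannedD.
    apply: spanned_mono sy => _ [c [u [q [w [[e es ewE] qw ->]]]]].
    by exists c, u, q, w; split=> //; exists e => //; rewrite mem_cat es.
  apply: spanned_mono sz => _ [c [u [q [w [[e es ewE] qw ->]]]]].
  by exists c, u, q, w; split=> //; exists e => //; rewrite mem_cat es orbT.
- exists (k *: a), (k *: y), s; split=> //; first by rewrite scalerDr.
    exact: spannedZ.
  exact: spannedZ.
Qed.

(** If [x e] is nonzero for an edge [e] leaving [v], the bound drops. Otherwise [v] is not regular
    by (CK2), so it is an infinite emitter, which contradicts [x <> 0], or a sink, where [x] has no
    ghost part. *)
Lemma reduction_bounded n v (x : L) : spanned (bounded_monomials n v) x -> x <> 0 ->
  exists q w, [/\ is_path v q w, x ** pelt q w <> 0 &
    spanned (real_paths w) (x ** pelt q w)].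
Proof.
elim: n v x => [|n IH] v x sx x0.
  have sr : spanned (real_paths v) x.
    apply: spanned_mono sx => _ [p [w [q [[u pw] qw q0 ->]]]].
    case: q qw q0 => // qw _; exists p; first by exists u; rewrite [v]qw.
    by rewrite gelt_nil pelt_target [v]qw.
  by exists [::], v; rewrite /= -/(vtx v) (real_paths_vtx sr).
have [[e ev xe]|noe] := pselect (exists2 e, source e = v & x ** edg e <> 0).
  have [q [w [qw xq sq]]] := IH _ _ (bounded_edg sx ev) xe.
  by exists (e :: q), w; rewrite /= nmulA.
have {}noe e : source e = v -> x ** edg e = 0.
  by move=> ev; apply: contrapT => xe; apply: noe; exists e.
have [a [y [s [xE sa sv sy]]]] := bounded_split sx.
have xv : x ** vtx v = x.
  elim: sx {x0 noe xE} => [|_ [p [w [q [_ qw _ ->]]]]|b c _ bv _ cv|k b _ bv].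
  - by rewrite nmul0.
  - by rewrite -nmulA (gelt_source K qw).
  - by rewrite nmulDl bv cv.
  - by rewrite nmulZl bv.
have nreg : ~ regular v.
  move=> reg; apply: x0; rewrite -xv (CK2 K reg) nmul_sumr big_seq big1// => e.
  by rewrite in_fset_set; [rewrite inE => /noe xe; rewrite nmulA xe nmul0|case: reg].
(* An edge [f] outside [s] kills [y], so [a f = x f = 0] and [a = 0]. Then [y = x] vanishes against
   all edges of [s], hence is zero. *)
have [[f fv fs]|emv] := pselect (exists2 f, source f = v & f \notin s).
  have yf : y ** edg f = 0.
    elim: sy {xE} => [|_ [c [u [q [w [[e es [-> ->]] _ ->]]]]]|b c _ bv _ cv|k b _ bv].
    - by rewrite nmul0.
    - rewrite gelt_cons gelt_nil target_gho -nmulA gho_edg; case: eqP => [ef|_].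
        by rewrite -ef es in fs.
      by rewrite nmulr0.
    - by rewrite nmulDl bv cv addr0.
    - by rewrite nmulZl bv scaler0.
  have a0 : a = 0.
    apply: (@real_path_cancel v [:: f] (target f) a sa); first by split.
    by rewrite /= -/(vtx _) edg_target -(addr0 (a ** _)) -yf -nmulDl -xE noe.
  case: x0; rewrite xE a0 add0r; apply: ghost_span_eq0 sy _ => q w [e es [-> ->]].
  by rewrite /= -/(vtx _) edg_target -[y]add0r -a0 -xE noe// sv.
(* Now [s] contains all edges leaving [v], so an element of [s] would make [v] regular; hence [s] is
   empty. *)
have y0 : y = 0.
  apply: ghost_span_eq0 sy _ => q w [e es _]; exfalso; apply: nreg.
  split; last by exists e; apply: sv.
  apply: sub_finite_set (finite_seq s) => f fv /=.
  by apply: contrapT => /negP fs; apply: emv; exists f.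
exists [::], v; rewrite /= -/(vtx v) xv; split=> //.
by rewrite xE y0 addr0.
Qed.

Lemma reduction (x : L) : x <> 0 ->
  exists q w, [/\ exists v, is_path v q w, x ** pelt q w <> 0 &
    spanned (real_paths w) (x ** pelt q w)].
Proof.
(* The algebra may lack a unit; [ghost_span_eq0] is applied to the empty ghost paths instead. *)
move=> x0; have [v xv] : exists v, x ** vtx v <> 0.
  apply: contrapT => xv; apply: x0.
  apply: (@ghost_span_eq0 K E [set t | t.1 = [::]]) => [|q w /= ->]; last first.
    by apply: contrapT => xw; apply: xv; exists w.
  apply: spanned_mono (leavitt_spanned x) => _ [u [p [w [u' [q [pw qw ->]]]]]].
  exists (pelt p w ** gelt q w), u', [::], u'; split=> //.
  by rewrite gelt_nil -nmulA (gelt_source K qw).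
have [n sn] : exists n, spanned (bounded_monomials n v) (x ** vtx v).
  elim: (leavitt_spanned x) => [|_ [u [p [w [u' [q [pw qw ->]]]]]]|y z _ [m sm] _ [n sn]
    |k y _ [n sn]].
  - by exists 0%N; rewrite nmul0; exact: spanned0.
  - exists (size q); rewrite -nmulA; have [vu|vu] := pselect (v = u'); last first.
      by rewrite (gelt_vtx0 K qw vu) nmulr0; exact: spanned0.
    rewrite vu (gelt_source K qw); apply: spanned_gen; exists p, w, q.
    by split=> //; exists u.
  - exists (maxn m n); rewrite nmulDl; apply: spannedD.
      apply: spanned_mono sm => _ [p [w [q [pw qw qn ->]]]].
      by exists p, w, q; split=> //; rewrite leq_max qn.
    apply: spanned_mono sn => _ [p [w [q [pw qw qn ->]]]].
    by exists p, w, q; split=> //; rewrite leq_max qn orbT.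
  - by exists n; rewrite nmulZl; exact: spannedZ.
have [q [w [qw xq sq]]] := reduction_bounded sn xv.
exists q, w; rewrite -nmulA (source_pelt K qw) in xq sq.
by split=> //; exists v.
Qed.

(** The element [t] is a real path ending at some [w] in [Y], found by prolonging the path of
    [reduction]; then [y t = y t w] lies in [J] for every [y]. The left-hand case follows by the
    involution. *)
Lemma dense_vertices (Y : set (vertex E)) (J : ideal L) :
  (forall v, exists2 w, Y w & tree v w) -> (forall w, Y w -> (J : set L) (vtx w)) ->
  dense_ideal (J : set L).
Proof.
move=> Ytree YJ; have id := idealP J.
have Jsub : additive_subgroup (J : set L).
  split=> [|x y Jx Jy]; first exact: is_ideal0 id.
  by rewrite -scaleN1r; apply: (is_idealD id) => //; apply: (is_idealZ id).
have right x : x <> 0 -> exists p w, (Y w /\ x ** pelt p w <> 0).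
  move=> /reduction[q [w [_ xq sq]]].
  have [w' Yw' [p pw']] := Ytree w.
  exists (q ++ p), w'; split=> //.
  by rewrite (pelt_cat _ _ pw') nmulA => /(real_path_cancel sq pw').
split; split.
- by split=> // x a; exact: is_idealMl.
- move=> x y x0; have [|p [w [Yw xp]]] := right (star x).
    by move=> sx; apply: x0; rewrite -[x]starK sx linear0.
  exists (gelt p w); split.
    move=> px; apply: xp; rewrite -[LHS]starK starM star_pelt starK px.
    exact: linear0.
  rewrite -target_gelt; apply: (is_idealMr id); apply: (is_idealMr id).
  exact: YJ.
- by split=> // x a; exact: is_idealMr.
- move=> x y /right[p [w [Yw xp]]]; exists (pelt p w); split=> //.
  rewrite -pelt_target; apply: (is_idealMl id); apply: (is_idealMl id).
  exact: YJ.
Qed.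

End Reduction.

(** * Where paths lead in a graph with finitely many vertices *)

Section FiniteGraph.
Variable E : digraph.
Implicit Types (u v w : vertex E) (c : seq (edge E)).

(** Moving to a vertex that does not lead back strictly shrinks the finite set [tree v]. *)
Lemma tree_terminal v : finite_set [set: vertex E] ->
  exists2 w, tree v w & forall u, tree w u -> tree u w.
Proof.
move=> fin; have finT (A : set (vertex E)) : finite_set A by exact: sub_finite_set fin.
have [n] := ubnP #|` fset_set (tree v)|; elim: n v => // n IH v; rewrite ltnS => vn.
have [[u vu nuv]|all] := pselect (exists2 u, tree v u & ~ tree u v); last first.
  exists v; first exact: tree_refl.
  by move=> u vu; apply: contrapT => uv; apply: all; exists u.
have [|w uw wP] := IH u; last by exists w => //; exact: tree_trans uw.
apply: leq_trans vn; apply: fproper_ltn_card; rewrite fproperEneq.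
apply/andP; split; last first.
  by apply/fsubsetP => w; rewrite !in_fset_set// !inE; exact: tree_trans.
apply/negP => /eqP/fsetP/(_ v); rewrite !in_fset_set// [RHS]mem_set; last first.
  exact: tree_refl.
by move/set_mem.
Qed.

(** A terminal vertex is a sink, hence a line point, or lies on a cycle. Such a cycle has no exits,
    or it is extreme since every path leaving it can return. *)
Lemma tree_lce v : finite_set [set: vertex E] ->
  exists2 w, (P_l E `|` P_c E `|` P_ec E) w & tree v w.
Proof.
move=> /(tree_terminal v)[w vw wP]; exists w => //.
have [[e ew]|now] := pselect (exists e, source e = w); last first.
  left; left => u [[|e p] /=]; last by case=> ew _; case: now; exists e.
  move=> <-; split; first by move=> [e [f [ew _ _]]]; apply: now; exists e.
  by move=> [c _ [e _ ew]]; apply: now; exists e.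
have [p ep] : tree (target e) w by apply: wP; exists [:: e].
have [|//|c cc cw] := @closed_path_cycle E w (e :: p); first by split.
have [c0|cex] := pselect (exits c = set0); first by left; right; exists c.
right; exists c => //; split=> //; first by apply/set0P/eqP.
move=> x q u cx xu; have [q' uw] : tree u w.
  apply: wP; apply: tree_trans (cycle_connected cc cw cx) _.
  by exists q.
by exists q', w.
Qed.

End FiniteGraph.

(** * The decomposition of I_lce *)

Section CycleClasses.
Variable E : digraph.
Implicit Types (u v w : vertex E) (e f : edge E) (p q z c d : seq (edge E)).

Lemma simple_closed_prefix u p z : is_path u p u -> p <> [::] ->
  is_path u (p ++ z) u -> uniq (map source (p ++ z)) -> z = [::].
Proof.
case: p => // e p pu _ /(is_path_cat u (e :: p))[x px xu].
have ux := is_path_end pu px; rewrite -{}ux in xu.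
case: z xu => // f z [fu _]; case: pu => eu _.
by rewrite map_cat cat_uniq /= inE fu eu eqxx andbF.
Qed.

Lemma rotations_rot c n : rotations (rot n c) = rotations c.
Proof.
have sub m d : rotations (rot m d) `<=` rotations d.
  by move=> _ [k _ <-]; rewrite rot_rot_add; exists (rot_add d m k).
apply/seteqP; split; first exact: sub.
by rewrite -{1}(rotK n c); exact: sub.
Qed.

Lemma cycle_rot c u : cycles c -> cycle_vertices c u ->
  exists n, is_path u (rot n c) u /\ uniq (map source (rot n c)).
Proof.
move=> [_ [v cv] uc] [e ec eu].
have ur n : uniq (map source (rot n c)) by rewrite map_rot rot_uniq.
case/splitPr: ec cv ur => c1 c2 /is_path_cat[x c1x [ex c2v]] ur.
exists (size c1); split=> //; rewrite rot_size_cat -eu.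
apply/(is_path_cat _ (e :: c2)); exists v; first by split.
by rewrite ex.
Qed.

(** Rotated to start at [u], the two cycles are comparable paths, and neither properly prolongs the
    other because its sources are distinct. *)
Lemma noexit_rotations c d u : noexit_cycles E c -> noexit_cycles E d ->
  cycle_vertices c u -> cycle_vertices d u -> rotations c = rotations d.
Proof.
move=> nc nd cu du; have dt := noexit_deterministic nc cu.
have [m [cm um]] := cycle_rot nc.1 cu; have [n [dn un]] := cycle_rot nd.1 du.
rewrite -(rotations_rot c m) -(rotations_rot d n); congr rotations.
have cm0 : rot m c <> [::] by move/(congr1 size); rewrite size_rot; case: (c) nc => // -[[]].
have dn0 : rot n d <> [::] by move/(congr1 size); rewrite size_rot; case: (d) nd => // -[[]].
have [[z zE]|[z zE]] := deterministic_prefix dt cm dn.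
  have z0 : z = [::] by apply: (simple_closed_prefix cm cm0); rewrite -zE.
  by rewrite zE z0 cats0.
have z0 : z = [::] by apply: (simple_closed_prefix dn dn0); rewrite -zE.
by rewrite zE z0 cats0.
Qed.

Lemma deterministic_tree_total v a b : deterministic v -> tree v a -> tree v b ->
  tree a b \/ tree b a.
Proof.
move=> dv [p pa] [q qb]; have [[z E1]|[z E1]] := deterministic_prefix dv pa qb.
  move: qb; rewrite E1 => /is_path_cat[x px xb]; left.
  by rewrite (is_path_end pa px); exists z.
move: pa; rewrite E1 => /is_path_cat[x qx xa]; right.
by rewrite (is_path_end qb qx); exists z.
Qed.

Lemma sink_tree u w : sinks E u -> tree u w -> w = u.
Proof.
move=> su [[|e p] /= ]; first by move=> ->.
by case=> eu _; have : emitted u e by []; rewrite su.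
Qed.

Lemma sink_line u : sinks E u -> P_l E u.
Proof.
move=> su w /(sink_tree su) ->; split; first by move=> [e [f []]]; rewrite su.
by move=> [c _ [e _ eu]]; have : emitted u e by []; rewrite su.
Qed.

Lemma extreme_return c v w : extreme_cycles E c -> cycle_vertices c v ->
  tree v w -> tree w v.
Proof.
move=> [cc _ ret] cv [p pw]; have [q [u [qu cu]]] := ret _ _ _ cv pw.
by apply: tree_trans (cycle_connected cc cu cv); exists q.
Qed.

Lemma cycle_vertex c : cycles c -> exists v, cycle_vertices c v.
Proof. by move=> [c0 [v cv] _]; exists v; exact: cycle_vertices_hd. Qed.

Lemma extreme_classP c d x : extreme_cycles E c -> cycle_vertices c x ->
  extreme_class c d <->
  extreme_cycles E d /\ exists2 y, cycle_vertices d y & tree x y.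
Proof.
move=> xc cx; have [cc _ _] := xc; split=> [[xd [y [[x' cx' x'y] dy]]]|[xd [y dy xy]]].
  split=> //; exists y => //; apply: tree_trans x'y.
  exact: cycle_connected cx cx'.
by split=> //; exists y; split=> //; exists x.
Qed.

(** Vertices reached from an extreme cycle lead back to it, so two cycles that both reach [u] reach
    each other. *)
Lemma extreme_class_disjoint c c' u : extreme_cycles E c -> extreme_cycles E c' ->
  trees (class_vertices (extreme_class c)) u ->
  trees (class_vertices (extreme_class c')) u ->
  extreme_class c = extreme_class c'.
Proof.
move=> xc xc'; have [cc _ _] := xc; have [cc' _ _] := xc'.
have [x cx] := cycle_vertex cc; have [x' cx'] := cycle_vertex cc'.
have to b y : extreme_cycles E b -> cycle_vertices b y ->
    trees (class_vertices (extreme_class b)) u -> tree y u.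
  move=> xb yb [v [d /(extreme_classP _ xb yb)[xd [z dz yz]] dv] vu].
  have [cd _ _] := xd.
  by apply: tree_trans vu; apply: tree_trans yz _; exact: cycle_connected dv.
move=> /(to _ _ xc cx) xu /(to _ _ xc' cx') x'u.
have xx' : tree x x' := tree_trans xu (extreme_return xc' cx' x'u).
have x'x : tree x' x := tree_trans x'u (extreme_return xc cx xu).
apply/seteqP; split=> d.
  move=> /(extreme_classP _ xc cx)[xd [y dy xy]]; apply/(extreme_classP _ xc' cx').
  by split=> //; exists y => //; exact: tree_trans xy.
move=> /(extreme_classP _ xc' cx')[xd [y dy xy]]; apply/(extreme_classP _ xc cx).
by split=> //; exists y => //; exact: tree_trans xy.
Qed.

Lemma extreme_class_refl c : extreme_cycles E c -> extreme_class c c.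
Proof.
move=> xc; have [cc _ _] := xc; have [x cx] := cycle_vertex cc.
by apply/(extreme_classP _ xc cx); split=> //; exists x => //; exact: tree_refl.
Qed.

Lemma line_noexit_disjoint : trees (P_l E) `&` trees (P_c E) = set0.
Proof.
apply/seteqP; split=> // u [[v lv vu] [w [c nc cw] wu]].
have [_ []] := lv _ vu.
by exists c; [exact: nc.1|exact: noexit_tree wu].
Qed.

Lemma line_extreme_disjoint : trees (P_l E) `&` trees (P_ec E) = set0.
Proof.
apply/seteqP; split=> // u [[v lv vu] [w [c xc cw] wu]].
have [_ []] := lv _ (tree_trans vu (extreme_return xc cw wu)).
by exists c => //; case: xc.
Qed.

(** A common vertex leads back to the extreme cycle and so to one of its exits, a bifurcation that a
    cycle without exits cannot reach. *)
Lemma noexit_extreme_disjoint : trees (P_c E) `&` trees (P_ec E) = set0.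
Proof.
apply/seteqP; split=> // u [[v [d nd dv] vu] [w [c xc cw] wu]].
have [cc [e [f fc [ef ne]]] _] := xc.
have vw := tree_trans vu (extreme_return xc cw wu).
have vf : tree v (source f).
  by apply: tree_trans vw _; apply: cycle_connected cw _ => //; exists f.
by apply: (noexit_deterministic nd dv vf); exists e, f.
Qed.

End CycleClasses.

(** * The three summands and their sum *)

Section Decomposition.
Variables (K : fieldType) (E : digraph).
Local Notation L := (leavitt K E).
Local Notation vtx := (vtx K).

(** Disjoint trees make the ideals of the [Y i] orthogonal, and the last two hypotheses make their
    sum the ideal of [Z]. *)
Lemma embeds_vertex_ideals (I : choiceType) (B : I -> nuAlgType K)
    (Y : I -> set (vertex E)) (Z : set (vertex E)) :
  (forall i, embeds (B i) (vertex_ideal K (Y i) : set L)) ->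
  (forall i j u, trees (Y i) u -> trees (Y j) u -> i = j) ->
  (forall i, Y i `<=` Z) ->
  (forall z, Z z -> exists i, (vertex_ideal K (Y i) : set L) (vtx z)) ->
  embeds (dsum B) (vertex_ideal K Z : set L).
Proof.
move=> emb disj YZ ZY.
have -> : (vertex_ideal K Z : set L) =
    ideal_gen (\bigcup_(i in [set: I]) (vertex_ideal K (Y i) : set L)).
  apply/seteqP; split.
    apply: vertex_ideal_min; first exact: idealP.
    by move=> z /ZY[i zi] J [_]; apply; exists i.
  apply: smallest_sub; first exact: idealP.
  move=> x [i _]; apply: vertex_ideal_min; first exact: idealP.
  move=> v Yv; apply: vertex_ideal_vtx; exists v; [exact: YZ Yv|exact: tree_refl].
apply: embeds_dsum => //.
- move=> i j x y ij; apply: vertex_ideal_orthogonal.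
  by apply/seteqP; split=> // u [ui uj]; apply: ij; exact: disj ui uj.
- move=> i x; exact: vertex_ideal_nondegenerate.
Qed.

Let lambda1 : choiceType := (set_type (sinks E) + set_type (infinite_sinks E))%type.

Lemma infinite_sink_repr (C : infinite_sinks E) : exists v, sinkless_line_points E v /\
  [set w | sinkless_line_points E w /\ tree v `&` tree w !=set0] = \val C.
Proof. by have [v sv <-] := set_valP C; exists v. Qed.

Definition line_repr (i : lambda1) : vertex E :=
  match i with
  | inl s => \val s
  | inr C => projT1 (cid (infinite_sink_repr C))
  end.

Lemma line_repr_line i : P_l E (line_repr i).
Proof.
case: i => [s|C] /=; first exact: sink_line (set_valP s).
by case: cid => v /= [[]].
Qed.

(** A line point reaches a sink or belongs to an infinite sink; in both cases its path merges with
    that of the representative, whose ideal then contains it. *)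
Lemma embeds_lines :
  embeds (dsum (fun i : lambda1 => fmatrix (set_type (first_entries (line_repr i))) K^o))
    (vertex_ideal K (P_l E) : set L).
Proof.
apply: (@embeds_vertex_ideals _ _ (fun i => [set line_repr i])).
- by move=> i; exact: (@embeds_line K E _ (@line_repr_line i)).
- have ss (s : sinks E) (C : infinite_sinks E) u :
      trees [set line_repr (inl s)] u -> trees [set line_repr (inr C)] u -> False.
    move=> [_ -> /(sink_tree (set_valP s)) ->] [_ -> /=].
    case: cid => v /= [[_ v0] _] vs.
    have : (tree v `&` sinks E) (\val s) by split=> //; exact: set_valP.
    by rewrite v0.
  move=> [s|C] [s'|C'] u.
  + move=> [_ -> /(sink_tree (set_valP s)) ->] [_ -> /(sink_tree (set_valP s'))].
    by move=> /val_inj ->.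
  + by move=> us uC; case: (ss _ _ _ us uC).
  + by move=> uC us; case: (ss _ _ _ us uC).
  + move=> [_ -> /= vu] [_ -> /= vu'].
    suff /val_inj -> : \val C = \val C' by [].
    move: vu vu'; case: cid => v /= [[lv _] <-]; case: cid => v' /= [[lv' _] <-].
    (* On the line from [a], one of [u] and [x] leads to the other, and the later one lies in both
       [tree b] and [tree w]. *)
    move=> vu v'u; have sub a b : P_l E a -> P_l E b -> tree a u -> tree b u ->
        forall w, tree a `&` tree w !=set0 -> tree b `&` tree w !=set0.
      move=> la lb au bu w [x [ax wx]].
      case: (deterministic_tree_total (line_deterministic la) au ax) => [ux|xu].
        by exists x; split=> //; exact: tree_trans ux.
      by exists u; split=> //; exact: tree_trans xu.
    by apply/seteqP; split=> w [sw] /sub; split=> //; auto.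
- by move=> i _ ->; exact: line_repr_line.
- move=> z lz; have dz := line_deterministic lz.
  have [[s [zs ss]]|zns] := pselect (tree z `&` sinks E !=set0).
    have sS : s \in sinks E by rewrite inE.
    exists (inl (SigSub sS)); apply: vertex_ideal_deterministic => //.
    by exists s; split=> //; exact: tree_refl.
  have sz : sinkless_line_points E z.
    by split=> //; apply: contrapT => /eqP/set0P.
  have CC : [set w | sinkless_line_points E w /\ tree z `&` tree w !=set0] \in infinite_sinks E.
    by rewrite inE; exists z.
  exists (inr (SigSub CC)); apply: vertex_ideal_deterministic => //=.
  case: cid => v /= [_ vE].
  have : [set w | sinkless_line_points E w /\ tree z `&` tree w !=set0] z.
    by split=> //; exists z; split; exact: tree_refl.
  by rewrite -vE => -[].
Qed.

Lemma noexit_class_repr (C : noexit_classes E) : exists cv : seq (edge E) * vertex E,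
  [/\ noexit_cycles E cv.1, rotations cv.1 = \val C & is_path cv.2 cv.1 cv.2].
Proof.
have [c nc <-] := set_valP C; have [_ [v cv] _] := nc.1.
by exists (c, v).
Qed.

Definition noexit_repr C : seq (edge E) * vertex E := projT1 (cid (noexit_class_repr C)).

Lemma noexit_reprP C : [/\ noexit_cycles E (noexit_repr C).1,
  rotations (noexit_repr C).1 = \val C &
  is_path (noexit_repr C).2 (noexit_repr C).1 (noexit_repr C).2].
Proof. by rewrite /noexit_repr; case: cid. Qed.

Lemma noexit_repr_vertex C : cycle_vertices (noexit_repr C).1 (noexit_repr C).2.
Proof. by have [[[c0 _ _] _] _ cv] := noexit_reprP C; exact: cycle_vertices_hd. Qed.

Lemma embeds_noexit :
  embeds (dsum (fun C : noexit_classes E =>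
      fmatrix (set_type (first_entries (noexit_repr C).2)) (laurent K)))
    (vertex_ideal K (P_c E) : set L).
Proof.
apply: (@embeds_vertex_ideals _ _ (fun C => [set (noexit_repr C).2])).
- by move=> C; have [nc _ cv] := noexit_reprP C; exact: (@embeds_cycle K E _ _ nc cv).
- move=> C C' u [_ -> vu] [_ -> v'u]; apply: val_inj.
  have [nc <- _] := noexit_reprP C; have [nc' <- _] := noexit_reprP C'.
  apply: (noexit_rotations nc nc' (u := u)).
    exact: noexit_tree (noexit_repr_vertex C) vu.
  exact: noexit_tree (noexit_repr_vertex C') v'u.
- move=> C _ ->; exists (noexit_repr C).1; last exact: noexit_repr_vertex.
  by case: (noexit_reprP C).
- move=> z [d nd dz].
  have dC : rotations d \in noexit_classes E by rewrite inE; exists d.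
  exists (SigSub dC); apply: vertex_ideal_deterministic.
    exact: noexit_deterministic dz.
  have [nc cE _] := noexit_reprP (SigSub dC).
  have : rotations (noexit_repr (SigSub dC)).1 d by rewrite cE; exists 0%N => //; rewrite rot0.
  move=> [n _ dE]; have [e ed ez] := dz.
  exists z; split; last exact: tree_refl.
  apply: cycle_connected nc.1 (noexit_repr_vertex _) _.
  by exists e => //; rewrite -dE mem_rot in ed.
Qed.

Lemma embeds_extreme :
  embeds (dsum (fun l : X_ec E => ideal_sort (vertex_ideal K (class_vertices (\val l)))))
    (vertex_ideal K (P_ec E) : set L).
Proof.
apply: (@embeds_vertex_ideals _ _ (fun l : X_ec E => class_vertices (\val l))).
- by move=> l; exact: embeds_ideal_sort.
- move=> l l' u lu l'u; apply: val_inj; move: lu l'u.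
  have [c xc <-] := set_valP l; have [c' xc' <-] := set_valP l'.
  exact: extreme_class_disjoint.
- move=> l v [d dl dv]; have [c xc cE] := set_valP l; move: dl.
  by rewrite -cE => -[xd _]; exists d.
- move=> z [c xc cz]; have cX : extreme_class c \in X_ec E by rewrite inE; exists c.
  exists (SigSub cX); apply: vertex_ideal_vtx; exists z; last exact: tree_refl.
  by exists c => //; exact: extreme_class_refl.
Qed.

Lemma embeds_I_lce :
  embeds (dsum (fun i : lambda1 => fmatrix (set_type (first_entries (line_repr i))) K^o) *
          dsum (fun C : noexit_classes E =>
                  fmatrix (set_type (first_entries (noexit_repr C).2)) (laurent K)) *
          dsum (fun l : X_ec E => ideal_sort (vertex_ideal K (class_vertices (\val l)))))%type
    (I_lce K E : set L).
Proof.
have orth Y Z (x y : L) : trees Y `&` trees Z = set0 ->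
    (vertex_ideal K Y : set L) x -> (vertex_ideal K Z : set L) y ->
    x ** y = 0 /\ y ** x = 0.
  move=> YZ Yx Zy; split; first exact: vertex_ideal_orthogonal YZ Yx Zy.
  by apply: vertex_ideal_orthogonal Zy Yx; rewrite setIC.
apply: embeds_pair; first apply: embeds_pair.
- exact: embeds_lines.
- exact: embeds_noexit.
- by move=> x y; apply: orth; exact: line_noexit_disjoint.
- by move=> x; exact: vertex_ideal_nondegenerate.
- exact: embeds_extreme.
- move=> _ y [a la [b cb <-]] Zy.
  have [ay ya] := orth _ _ _ _ (line_extreme_disjoint E) la Zy.
  have [by0 yb] := orth _ _ _ _ (noexit_extreme_disjoint E) cb Zy.
  by rewrite nmulDl nmulDr ay ya by0 yb addr0.
- by move=> x; exact: vertex_ideal_nondegenerate.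
Qed.

End Decomposition.

Theorem theorem2p9 (K : fieldType) (E : digraph) :
  (exists (m : Lambda1 E -> choiceType) (n : noexit_classes E -> choiceType),
    [/\ forall i, inhabited (m i),
        forall j, inhabited (n j) &
        nualg_iso (ideal_sort (I_lce K E))
          (dsum (fun i : Lambda1 E => fmatrix (m i) K^o) *
           dsum (fun j : noexit_classes E => fmatrix (n j) (laurent K)) *
           dsum (fun l : X_ec E =>
                   ideal_sort (vertex_ideal K (class_vertices (\val l)))))%type])
  /\
  (finite_set [set: vertex E] -> dense_ideal (I_lce K E)).
Proof.
split.
  exists (fun i => set_type (first_entries (line_repr i))).
  exists (fun C => set_type (first_entries (noexit_repr C).2)).
  (* The empty path at [v] is an entry, so no matrix algebra has size zero. *)
  have inh (v : vertex E) : inhabited (set_type (first_entries v)).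
    have vX : ([::], v) \in first_entries v.
      by rewrite inE; split=> //; [exact: tree_refl|exists v].
    by constructor; exact: SigSub vX.
  split=> [i|j|]; try exact: inh.
  exact: embeds_iso (embeds_I_lce K E).
move=> fin; apply: (@dense_vertices K E (P_l E `|` P_c E `|` P_ec E)).
  by move=> v; exact: tree_lce.
have vI Y w : Y w -> (vertex_ideal K Y : set (leavitt K E)) (vtx K w).
  by move=> Yw; apply: vertex_ideal_vtx; exists w => //; exact: tree_refl.
have v0 Y : (vertex_ideal K Y : set (leavitt K E)) 0 := is_ideal0 (idealP _).
move=> w [[lw|cw]|xw].
- exists (vtx K w); last by exists 0; rewrite ?addr0.
  by exists (vtx K w); [exact: vI|exists 0; rewrite ?addr0].
- exists (vtx K w); last by exists 0; rewrite ?addr0.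
  by exists 0 => //; exists (vtx K w); [exact: vI|rewrite add0r].
- exists 0; last by exists (vtx K w); [exact: vI|rewrite add0r].
  by exists 0 => //; exists 0; rewrite ?addr0.
Qed.
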